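(* Let $\dim V\ge 4$ and fix $J\in\mathcal{T}(V,g)$. Let $$\psi:E^{S}\to T\mathcal{T},\qquad \psi(A)=[FAF,\phi],$$ where a) $F=QS\in\Gamma(\mathfrak{gl}(\mathbb{V}))$ is such that $Q^{*}=Q$, $[Q,J]=0$, $[Q,\phi]=0$ and $S\in\{\mathbb{1},\,J+\phi,\,J-\phi,\,[J,\phi]\}$ (with $Q\in\Gamma(\mathfrak{gl}(\mathbb{V}))$); b) $E\in\{\mathfrak{o}(\mathbb{V},g),\ \mathfrak{o}_{\{\phi\}}(\mathbb{V}),\ \mathfrak{u}(\mathbb{V},J),\ \mathfrak{u}(\mathbb{V},\phi)\}$. Moreover, suppose that $$dQ_{[FCF,\phi]}=Q\,(dQ_{[SCS,\phi]})\,Q\qquad\text{for all } C\in\Gamma(E^{S}).$$ Then there exists a skew bracket $[\cdot,\cdot]_{F}$ on $\Gamma(E^{S})$ such that $(E^{S},[\cdot,\cdot]_{F},\psi)$ is a skew algebroid on $\mathcal{T}(V,g)$.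
   Context: $(V,g)$ is a $2n$-dimensional real vector space with a positive definite metric. $\mathcal{T}=\mathcal{T}(V,g)=\{K\in \mathrm{End}V : K^{2}=-1,\ g(K\cdot,K\cdot)=g(\cdot,\cdot)\}$, a submanifold of $\mathrm{End}V$, with $T_K\mathcal{T}=\{A\in\mathfrak{o}(V,g): AK+KA=0\}$. $\mathbb{V}=V\times\mathcal{T}$, $\mathfrak{gl}(\mathbb{V})=\mathrm{End}V\times\mathcal{T}$, $\mathfrak{o}(\mathbb{V},g)=\mathfrak{o}(V,g)\times\mathcal{T}$. $\phi$ is the section with $\phi|_K=K$; $J$ and $\mathbb{1}$ are regarded as constant sections. $A^{*}$ is the $g$-adjoint, $[A,B]=AB-BA$, $\{A,B\}=AB+BA$. $dQ_X$ is the derivative of the map $Q:\mathcal{T}\to\mathrm{End}V$ in direction $X$. Further bundles (conditions imposed pointwise on $\mathcal{T}$): $\mathfrak{u}(\mathbb{V},J)=\{A\in\mathfrak{o}(\mathbb{V},g):[A,J]=0\}$, $\mathfrak{u}(\mathbb{V},\phi)=\{A\in\mathfrak{o}(\mathbb{V},g):[A,\phi]=0\}$, $\mathfrak{o}_{\{\phi\}}(\mathbb{V})=\{A\in\mathfrak{o}(\mathbb{V},g):\{A,\phi\}=0\}$. Definition of $E^{S}$: for $S\in\{\mathbb{1},J+\phi,J-\phi,[J,\phi]\}$ and $\gamma\in\{\pm J,\pm\phi\}$ there is a unique $\tilde\gamma\in\{\pm J,\pm\phi\}$ with $\gamma S=S\tilde\gamma$, and it is also the unique element of $\{\pm J,\pm\phi\}$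 with $S\gamma=\tilde\gamma S$. If $E=\{A\in\mathfrak{o}(\mathbb{V},g):\gamma A=A\delta\}$ with $\gamma\in\{\pm J,\pm\phi\}$ and $\delta\in\{+\gamma,-\gamma\}$, then $E^{S}=\{B\in\mathfrak{o}(\mathbb{V},g):\tilde\gamma B=B\tilde\delta\}$, where $\gamma S=S\tilde\gamma$ and $S\delta=\tilde\delta S$. If $E=\mathfrak{o}(\mathbb{V},g)$ then $E^{S}=\mathfrak{o}(\mathbb{V},g)$. A skew algebroid $(E,[\cdot,\cdot],\psi)$ on $\mathcal{T}$ is a vector bundle with a skew bracket on $\Gamma(E)$ and a bundle map $\psi:E\to T\mathcal{T}$ such that $\psi([A,B])=[\psi(A),\psi(B)]_{Lie}$ and $[A,fB]=f[A,B]+\psi(A)[f]B$ for all $A,B\in\Gamma(E)$, $f\in C^\infty(\mathcal{T})$. *)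

(* Defs.v *)
From HB Require Import structures.
From mathcomp Require Import all_boot all_order all_algebra.
From mathcomp Require Import all_classical all_reals all_analysis.
Set Implicit Arguments.
Unset Strict Implicit.
Unset Printing Implicit Defensive.
Import Order.TTheory GRing.Theory Num.Theory.
Import numFieldNormedType.Exports VectorInternalTheory.
Local Open Scope classical_set_scope.
Local Open Scope ring_scope.

(* Derivatives of all orders k <= m exist and are continuous on U (U open). *)
Fixpoint Cm (R : realType) (p q m : nat) (U : set 'rV[R]_p)
    (F : 'rV[R]_p -> 'rV[R]_q) : Prop :=
  match m with
  | 0 => forall x, U x -> {for x, continuous F}
  | m'.+1 => (forall x, U x -> differentiable F x) /\
             (forall v, Cm m' U (fun x => 'D_v F x))
  end.

Definition Coo (R : realType) (p q : nat) (U : set 'rV[R]_p)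
    (F : 'rV[R]_p -> 'rV[R]_q) : Prop := forall m, Cm m U F.

Section Twistor.
Context {R : realType} {V : vectType R}.
Implicit Type g : {dot V for idfun}.

Definition commE (A B : 'End(V)) : 'End(V) := (A \o B)%VF - (B \o A)%VF.
Definition acommE (A B : 'End(V)) : 'End(V) := (A \o B)%VF + (B \o A)%VF.

Definition self_adjoint g : set 'End(V) :=
  [set A | forall u v, g (A u) v = g u (A v)].
Definition oV g : set 'End(V) :=
  [set A | forall u v, g (A u) v = - g u (A v)].

Definition twistor g : set 'End(V) :=
  [set K | (K \o K)%VF = - \1%VF /\ forall u v, g (K u) (K v) = g u v].

Section FixedMetric.
Variable g : {dot V for idfun}.
Implicit Types K : twistor g.

Definition phi K : 'End(V) := val K.

Definition tangent K : set 'End(V) :=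
  [set A | oV g A /\ acommE A (phi K) = 0].

(** Smooth maps on the submanifold [twistor g] of End V.  End V and the target
    carry no canonical topology in the library; the coordinates [v2r], a linear
    isomorphism with row vectors, provide it. *)
Section Smooth.
Context {W : vectType R}.

Definition near_pt K (U : set 'rV[R]_(dim 'End(V))) : Prop :=
  open U /\ U (v2r (phi K)).

Definition local_ext (f : twistor g -> W) K
    : set ('rV[R]_(dim 'End(V)) -> 'rV[R]_(dim W)) :=
  [set F | exists U, [/\ near_pt K U, Coo U F &
     forall K', U (v2r (phi K')) -> F (v2r (phi K')) = v2r (f K')]].

Definition smooth_at (f : twistor g -> W) K : Prop :=
  local_ext f K !=set0.

Definition smooth (f : twistor g -> W) : Prop := forall K, smooth_at f K.

(* Derivative at K in direction X, computed on a local smooth extension of f;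
   for X tangent to [twistor g] at K the value does not depend on the extension.
   Used only for such X. *)
Definition dT (f : twistor g -> W) K (X : 'End(V)) : W :=
  r2v ('D_(v2r X) (xget (fun=> 0) (local_ext f K)) (v2r (phi K))).

End Smooth.

(* Bundles are families of subsets of End V, sections are End V-valued maps. *)
Definition bundle := twistor g -> set 'End(V).
Definition section := twistor g -> 'End(V).

Definition Gamma (E : bundle) : set section :=
  [set A | smooth A /\ forall K, E K (A K)].

Definition is_vector_bundle (E : bundle) : Prop :=
  forall K0, exists (m : nat) (b : 'I_m -> section) U,
    near_pt K0 U /\
    forall K, U (v2r (phi K)) ->
      [/\ forall i, smooth_at (b i) K,
          free [tuple b i K | i < m] &
          E K = [set A | A \in <<[tuple b i K | i < m]>>%VS]].

Definition bundle_map_T (E : bundle)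
    (psi : twistor g -> 'End(V) -> 'End(V)) : Prop :=
  [/\ forall K A, E K A -> tangent K (psi K A),
      forall K (a : R) A B, E K A -> E K B ->
        psi K (a *: A + B) = a *: psi K A + psi K B &
      forall A, Gamma E A -> smooth (fun K => psi K (A K))].

(* Z = [X, Y]_Lie, as derivations of C^oo(T). *)
Definition is_lie_bracket (X Y Z : section) : Prop :=
  forall f : twistor g -> R^o, smooth f -> forall K,
    dT f K (Z K) = dT (fun K' => dT f K' (Y K')) K (X K)
                    - dT (fun K' => dT f K' (X K')) K (Y K).

Definition skew_bracket (E : bundle) (br : section -> section -> section)
    : Prop :=
  [/\ forall A B, Gamma E A -> Gamma E B -> Gamma E (br A B),
      forall (a : R) A B C, Gamma E A -> Gamma E B -> Gamma E C ->
        br (fun K => a *: A K + B K) C = (fun K => a *: br A C K + br B C K) &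
      forall A B, Gamma E A -> Gamma E B -> br A B = (fun K => - br B A K)].

Definition skew_algebroid (E : bundle) (br : section -> section -> section)
    (psi : twistor g -> 'End(V) -> 'End(V)) : Prop :=
  [/\ is_vector_bundle E, skew_bracket E br, bundle_map_T E psi,
      forall A B, Gamma E A -> Gamma E B ->
        is_lie_bracket (fun K => psi K (A K)) (fun K => psi K (B K))
          (fun K => psi K (br A B K)) &
      forall A B (f : twistor g -> R^o),
        Gamma E A -> Gamma E B -> smooth f ->
        br A (fun K => f K *: B K) =
          (fun K => f K *: br A B K + dT f K (psi K (A K)) *: B K)].

Section Twist.
Variable J : 'End(V).
Implicit Types S gam del : section.

Definition cst_sec A : section := fun=> A.
Definition opp_sec (A : section) : section := fun K => - A K.

Definition pmJphi : set section :=
  [set gam | [\/ gam = cst_sec J, gam = opp_sec (cst_sec J),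
                 gam = phi | gam = opp_sec phi]].

Definition S_set : set section :=
  [set S | [\/ S = cst_sec \1%VF, S = (fun K => J + phi K),
               S = (fun K => J - phi K) | S = (fun K => commE J (phi K))]].

Definition intertwine gam del : bundle :=
  fun K => [set A | oV g A /\ (gam K \o A)%VF = (A \o del K)%VF].

(* The unique element of {+-J, +-phi} such that
   gam S = S (tilde gam) and S gam = (tilde gam) S. *)
Definition tilde S gam : section :=
  xget gam [set gam' | [/\ pmJphi gam',
    forall K, (gam K \o S K)%VF = (S K \o gam' K)%VF &
    forall K, (S K \o gam K)%VF = (gam' K \o S K)%VF]].

Inductive bundle_label := Orth | OrthAntiPhi | UnitaryJ | UnitaryPhi.

Definition bundle_of (E : bundle_label) : bundle := fun K =>
  match E with
  | Orth => oV g
  | OrthAntiPhi => [set A | oV g A /\ acommE A (phi K) = 0]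
  | UnitaryJ => [set A | oV g A /\ commE A J = 0]
  | UnitaryPhi => [set A | oV g A /\ commE A (phi K) = 0]
  end.

(* The pair (gam, del) with E = {A in o(V, g) : gam A = A del}, if any. *)
Definition presentation (E : bundle_label) : option (section * section) :=
  match E with
  | Orth => None
  | OrthAntiPhi => Some (phi : section, opp_sec phi)
  | UnitaryJ => Some (cst_sec J, cst_sec J)
  | UnitaryPhi => Some (phi : section, phi : section)
  end.

Definition present (p : option (section * section)) : bundle :=
  if p is Some (gam, del) then intertwine gam del else fun=> oV g.

Lemma presentationE (E : bundle_label) : present (presentation E) = bundle_of E.
Proof.
apply/funext => K; apply/seteqP.
case: E; first by split.
all: split=> A /= [oA H]; split=> //; move: H;
  rewrite /commE /acommE /cst_sec /opp_sec ?comp_lfunNr.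
- by move=> ->; rewrite addrN.
- by move/eqP; rewrite addrC addr_eq0 => /eqP.
- by move=> ->; rewrite subrr.
- by move/eqP; rewrite subr_eq0 => /eqP ->.
- by move=> ->; rewrite subrr.
- by move/eqP; rewrite subr_eq0 => /eqP ->.
Qed.

(* twist S E is E^S. *)
Definition twist S (E : bundle_label) : bundle :=
  present (omap (fun p => (tilde S p.1, tilde S p.2)) (presentation E)).

End Twist.
End FixedMetric.
End Twistor.

(* Main.v *)
Require Import Defs.
From HB Require Import structures.
From mathcomp Require Import all_boot all_order all_algebra.
From mathcomp Require Import all_classical all_reals all_analysis.
From mathcomp Require Import ring lra zify.
Import Order.TTheory GRing.Theory Num.Theory.
Import numFieldNormedType.Exports VectorInternalTheory.
Local Open Scope classical_set_scope.
Local Open Scope ring_scope.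
Set Implicit Arguments. Unset Strict Implicit. Unset Printing Implicit Defensive.

(** Write M_A = FAF.  Since the derivative of phi in direction X is X, and
    psi(A) = [M_A, phi], the product rule and the Jacobi identity give
      [psi A, psi B] = [ d(M_B)_(psi A) - d(M_A)_(psi B) - [M_A, M_B], phi ]
    for the Lie bracket of vector fields ([psi_raw_bracket]).  So it is enough
    to find a bracket C of A and B with FCF equal to the expression D paired
    with phi on the right-hand side, up to endomorphisms commuting with phi.

    D is of the form FCF because dF_(psi A) is divisible by F on both sides.
    Indeed F = QS = SQ; the hypothesis on Q gives dQ_(psi A) = Q q Q with
    q = dQ_[SAS, phi], and a look at the four choices of S gives
    dS_(psi A) = F Z F with Z built from A ([dS_psi_factors]).  Hence
      dF_(psi A) = (Qq + QFZ) F = F (qQ + ZFQ)       ([dF_psi_factors]),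
    and M_A M_B = F (A F^2 B) F, so that D = FCF for
      C = dB_(psi A) - dA_(psi B) + L_A B + B R_A - L_B A - A R_B
          - (A F^2 B - B F^2 A),   L_A = qQ + ZFQ,   R_A = Qq + QFZ.
    L_A and R_A are adjoint to each other, so C is skew-adjoint; L_A and R_A
    depend on A pointwise, so C obeys the Leibniz rule.

    When E is the bundle of all skew endomorphisms this is the bracket.  In
    the other cases E^S = {A : s A = e A s} with s^2 = -1 and e = 1 or -1, and
    C is replaced by its projection (C - e s C s) / 2 to E^S.  As F intertwines
    s with some gamma in {J, phi}, this replaces D by (D - e gamma D gamma) / 2.
    For gamma = phi and e = -1 that does not change [D, phi]; for e = 1 it
    changes nothing, because D then commutes with gamma: M_A and M_B do, and
    the derivatives of M_A and M_B do as well.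

    The rest makes this calculus available on the space of orthogonal complex
    structures.  Derivatives computed on smooth extensions depend on the map
    only, because every tangent vector is the velocity of a Cayley curve
    (1 + tB) K (1 + tB)^-1 ([twistor_curve], [dT_ext]); the commutator of vector
    fields acts on functions as expected because second derivatives commute
    ([Coo_derive_comm], [is_lie_bracket_dT]); E^S is locally trivial because
    1 - K K0 conjugates K0 to K ([phi_is_vector_bundle]).  Finally E^S is given
    through a choice of gamma~ with gamma S = S gamma~; the dimension hypothesis
    makes this choice unique, hence odd in gamma ([tilde_opp]), which is what
    turns E^S into an eigenbundle for the anti-commuting case. *)

(** * Calculus on row vectors *)

Section RowCalculus.
Context {R : realType}.

Lemma continuous_sumr (T : topologicalType) (W : normedModType R) (I : Type)
    (r : seq I) (h : I -> T -> W) :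
  (forall i, continuous (h i)) -> continuous (fun x => \sum_(i <- r) h i x).
Proof. by move=> hc; apply: continuous_big => //; exact: add_continuous. Qed.

Lemma linear_row_continuous p (W : normedModType R)
  (L : {linear 'rV[R]_p -> W}) : continuous L.
Proof.
have -> : (L : 'rV[R]_p -> W) = fun y => \sum_i y 0 i *: L (delta_mx 0 i).
  by apply/funext=> y; rewrite {1}(row_sum_delta y) linear_sum; under eq_bigr do rewrite linearZ.
by apply: continuous_sumr => i x; apply: cvgZr_tmp; [exact: nbhs_filter|exact: (@coord_continuous _ _ _ 0 i)].
Qed.

Lemma bilinear_row_continuous p q (W : normedModType R)
  (b : {bilinear 'rV[R]_p -> 'rV[R]_q -> W}) :
  continuous (fun z => b z.1 z.2).
Proof.
have -> : (fun z : 'rV[R]_p * 'rV[R]_q => b z.1 z.2) =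
    fun z => \sum_i z.1 0 i *: \sum_j z.2 0 j *: b (delta_mx 0 i) (delta_mx 0 j).
  apply/funext=> -[y z] /=; rewrite {1}(row_sum_delta y) linear_sumlz.
  apply: eq_bigr => i _; rewrite linearZl_LR {1}(row_sum_delta z) linear_sumr.
  by congr (_ *: _); apply: eq_bigr => j _; rewrite linearZr_LR.
apply: continuous_sumr => i x; apply: cvgZ.
  by apply: (@continuous_comp _ _ _ fst (fun M : 'rV[R]_p => M 0 i));
    [exact: cvg_fst | exact: coord_continuous].
apply: continuous_sumr => j {}x; apply: cvgZr_tmp.
by apply: (@continuous_comp _ _ _ snd (fun M : 'rV[R]_q => M 0 j));
  [exact: cvg_snd | exact: coord_continuous].
Qed.

(** The candidate differential of [h] is that of [f], and the remainders agree near [x]. *)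
Lemma differentiable_near_eq (X Y : normedModType R) (f h : X -> Y) x :
  (\near x, f x = h x) -> differentiable f x -> differentiable h x.
Proof.
move=> fh df.
have fh0 : \forall y \near (0 : X), f (y + x) = h (y + x).
  by move: fh; rewrite (near_shift 0 x) subr0.
have e : h \o shift x = cst (h x) + 'd f x +o_ 0 id.
  apply/eqaddoP => eps eps0; move/diff_locally/eqaddoP : df => /(_ _ eps0) dfe.
  near=> y; rewrite -(nbhs_singleton fh).
  have -> : (h \o shift x - (cst (f x) + 'd f x)) y =
            (f \o shift x - (cst (f x) + 'd f x)) y.
    by rewrite !fctE /=; congr (_ - _); apply/esym; near: y.
  by near: y.
apply/diff_locallyP; rewrite (diff_unique _ e); last exact: diff_continuous.
by split=> //; exact: diff_continuous.
Unshelve. all: by end_near. Qed.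

Lemma open_near (X : topologicalType) (U : set X) (P : X -> Prop) x :
  open U -> U x -> (forall y, U y -> P y) -> \near x, P x.
Proof. by move=> oU Ux UP; apply: filterS UP _; exact: open_nbhs_nbhs. Qed.

Section Cm.
Variables p q : nat.
Implicit Types (U : set 'rV[R]_p) (F G : 'rV[R]_p -> 'rV[R]_q).

(** [Cm] only looks at germs along [U]; this is what allows derivatives to be
    rewritten by product rules, which hold on [U] alone. *)
Lemma eq_Cm m U F G : open U -> (forall x, U x -> F x = G x) ->
  Cm m U F -> Cm m U G.
Proof.
move=> oU; elim: m F G => [|m IH] F G FG /=.
  move=> cF x Ux; rewrite /prop_for /continuous_at -(FG x Ux).
  apply: cvg_trans (cF x Ux); apply: near_eq_cvg; first exact: nbhs_filter.
  by apply: (open_near oU Ux) => y /FG ->.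
move=> [dF CF]; split=> [x Ux|v].
  by apply: differentiable_near_eq (dF x Ux); apply: (open_near oU Ux) => y /FG.
apply: IH (CF v) => x Ux.
by apply: near_eq_derive; apply: (open_near oU Ux) => y /FG.
Qed.

Lemma sub_Cm m U U' F : U' `<=` U -> Cm m U F -> Cm m U' F.
Proof.
move=> UU; elim: m F => [|m IH] F /=; first by move=> cF x /UU; exact: cF.
by move=> [dF CF]; split=> [x /UU|v]; [exact: dF|exact/IH/CF].
Qed.

Lemma CmD m U F G : open U -> Cm m U F -> Cm m U G -> Cm m U (F + G).
Proof.
move=> oU; elim: m F G => [|m IH] F G /=.
  by move=> cF cG x Ux; apply: cvgD; [exact: nbhs_filter|exact: cF|exact: cG].
move=> [dF CF] [dG CG]; split=> [x Ux|v].
  by apply: differentiableD; [exact: dF|exact: dG].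
apply: (@eq_Cm _ _ ((fun x => 'D_v F x) + (fun x => 'D_v G x))) => // [x Ux|].
  by rewrite deriveD //; apply: diff_derivable; [exact: dF|exact: dG].
exact: IH.
Qed.

Lemma Cm_cst m U (c : 'rV[R]_q) : Cm m U (cst c).
Proof.
elim: m c => [|m IH] c /=; first by move=> x _; exact: cst_continuous.
split=> [x _|v]; first exact: differentiable_cst.
by rewrite (_ : (fun _ => _) = cst 0) //; apply/funext=> x; rewrite derive_cst.
Qed.

Lemma Coo_derive U F v : Coo U F -> Coo U (fun x => 'D_v F x).
Proof. by move=> CF m; case: (CF m.+1) => _; exact. Qed.

Lemma Coo_diff U F x : Coo U F -> U x -> differentiable F x.
Proof. by move=> /(_ 1%N)[dF _]; exact: dF. Qed.

End Cm.

Lemma derive_linear (X : normedModType R) q r (F : X -> 'rV[R]_q)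
  (L : {linear 'rV[R]_q -> 'rV[R]_r}) x v : differentiable F x ->
  'D_v (L \o F) x = L ('D_v F x).
Proof.
move=> dF.
have dL : differentiable L (F x) by exact/linear_differentiable/linear_row_continuous.
rewrite deriveE; last exact: differentiable_comp.
rewrite (diff_comp dF dL) [in RHS]deriveE //= diff_lin //.
exact: linear_row_continuous.
Qed.

Lemma Coo_linear p q r U (F : 'rV[R]_p -> 'rV[R]_q)
  (L : {linear 'rV[R]_q -> 'rV[R]_r}) : open U -> Coo U F -> Coo U (L \o F).
Proof.
move=> oU CF m; elim: m F CF => [|m IH] F CF /=.
  move=> x Ux; apply: continuous_comp; first exact: (CF 0).
  exact: linear_row_continuous.
split=> [x Ux|v].
  apply: differentiable_comp; first exact: Coo_diff CF Ux.
  exact/linear_differentiable/linear_row_continuous.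
apply: (@eq_Cm _ _ _ _ (L \o (fun x => 'D_v F x))) => // [x Ux|].
  by rewrite derive_linear //; exact: Coo_diff CF Ux.
exact/IH/Coo_derive.
Qed.

Lemma differentiable_bilinear (X : normedModType R) q r s
  (b : {bilinear 'rV[R]_q -> 'rV[R]_r -> 'rV[R]_s})
  (F : X -> 'rV[R]_q) (G : X -> 'rV[R]_r) x :
  differentiable F x -> differentiable G x ->
  differentiable (fun x => b (F x) (G x)) x.
Proof.
move=> dF dG.
apply: (@differentiable_comp _ _ _ _ (fun x => (F x, G x)) (fun z => b z.1 z.2)).
  exact: differentiable_pair.
exact/differentiable_bilin/bilinear_row_continuous.
Qed.

Lemma derive_bilinear (X : normedModType R) q r s
  (b : {bilinear 'rV[R]_q -> 'rV[R]_r -> 'rV[R]_s})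
  (F : X -> 'rV[R]_q) (G : X -> 'rV[R]_r) x v :
  differentiable F x -> differentiable G x ->
  'D_v (fun x => b (F x) (G x)) x = b ('D_v F x) (G x) + b (F x) ('D_v G x).
Proof.
move=> dF dG.
have dp : differentiable (fun x => (F x, G x)) x by exact: differentiable_pair.
have cb := @bilinear_row_continuous _ _ _ b.
have db : differentiable (fun z => b z.1 z.2) ((fun x => (F x, G x)) x).
  exact: differentiable_bilin.
rewrite deriveE; last exact: differentiable_bilinear.
have /= -> := congr1 (@^~ v) (diff_comp dp db).
rewrite diff_bilin // diff_pair //= addrC [in RHS]deriveE // [in RHS]deriveE //.
Qed.

(** The product rule turns a derivative of [b F G] into two maps of the same kind,
    so the induction is on the order of differentiation for all [F] and [G] at once. *)
Lemma Coo_bilinear p q r s U (b : {bilinear 'rV[R]_q -> 'rV[R]_r -> 'rV[R]_s})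
  (F : 'rV[R]_p -> 'rV[R]_q) (G : 'rV[R]_p -> 'rV[R]_r) :
  open U -> Coo U F -> Coo U G -> Coo U (fun x => b (F x) (G x)).
Proof.
move=> oU CF CG m; elim: m F G CF CG => [|m IH] F G CF CG /=.
  move=> x Ux; apply: differentiable_continuous.
  by apply: differentiable_bilinear; [exact: Coo_diff CF Ux|exact: Coo_diff CG Ux].
split=> [x Ux|v].
  by apply: differentiable_bilinear; [exact: Coo_diff CF Ux|exact: Coo_diff CG Ux].
apply: (@eq_Cm _ _ _ _ ((fun x => b ('D_v F x) (G x)) + (fun x => b (F x) ('D_v G x)))) => //.
  by move=> x Ux; rewrite derive_bilinear //; [exact: Coo_diff CF Ux|exact: Coo_diff CG Ux].
by apply: CmD => //; apply: IH => //; exact: Coo_derive.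
Qed.
End RowCalculus.

(** * Symmetry of second derivatives *)

Section Schwarz.
Context {R : realType} {X : normedModType R}.
Implicit Types (f : X -> R) (u v x y z : X).

Lemma is_derive_line f z u (s : R) : differentiable f (z + s *: u) ->
  is_derive s 1 (fun s => f (z + s *: u)) ('D_u f (z + s *: u)).
Proof.
move=> df; have df' : derivable f (z + s *: u) u by exact: diff_derivable.
have e : (fun h : R => h^-1 *: (((fun s => f (z + s *: u)) \o shift s) (h *: 1) - f (z + s *: u)))
  = (fun h : R => h^-1 *: ((f \o shift (z + s *: u)) (h *: u) - f (z + s *: u))).
  apply/funext=> h /=; congr (_ *: (f _ - _)).
  by rewrite scalerDl addrCA [h *: 1]mulr1.
split; first by rewrite /derivable e.
by rewrite /derive e.
Qed.

Lemma derive_translate f y u w : 'D_u (fun y => f (y + w)) y = 'D_u f (y + w).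
Proof.
rewrite /derive; set a := (fun h : R => _); set b := (fun h : R => _).
by suff -> : a = b by []; apply/funext=> h; rewrite /a /b /= addrA.
Qed.

Lemma differentiable_translate f y w : differentiable f (y + w) ->
  differentiable (fun y => f (y + w)) y.
Proof.
by move=> df; apply: (@differentiable_comp _ _ _ _ (fun y => y + w) f).
Qed.

Lemma MVT_line f z u (h : R) : 0 < h ->
  (forall s, 0 <= s <= h -> differentiable f (z + s *: u)) ->
  exists2 c, 0 <= c <= h & f (z + h *: u) - f z = h * 'D_u f (z + c *: u).
Proof.
move=> h0 df.
have [s sh||c ch] := @MVT R (fun s => f (z + s *: u))
  (fun s => 'D_u f (z + s *: u)) 0 h h0.
- apply: is_derive_line; apply: df.
  by move: sh; rewrite in_itv /= => /andP[/ltW -> /ltW].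
- apply: derivable_within_continuous => s; rewrite in_itv /= => /df ds.
  by have [] := is_derive_line ds.
rewrite scale0r addr0 subr0 => e; exists c; last by rewrite e mulrC.
by move: ch; rewrite in_itv /= => /andP[/ltW -> /ltW].
Qed.

(** The mean value theorem is applied along [u] to the increment of [f] in direction
    [h *: v], and then along [v] to the derivative of [f] in direction [u].  The left
    side is symmetric in [u] and [v], which is the point of the lemma. *)
Lemma second_difference f x u v (h : R) : 0 < h ->
  (forall s t, 0 <= s <= h -> 0 <= t <= h -> differentiable f (x + s *: u + t *: v)) ->
  (forall s t, 0 <= s <= h -> 0 <= t <= h -> differentiable ('D_u f) (x + s *: u + t *: v)) ->
  exists s t, [/\ 0 <= s <= h, 0 <= t <= h &
   (f (x + h *: u + h *: v) - f (x + h *: u)) - (f (x + h *: v) - f x) =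
     h * (h * 'D_v ('D_u f) (x + s *: u + t *: v))].
Proof.
move=> h0 df ddf.
have h0h : 0 <= (0 : R) <= h by rewrite lexx ltW.
have hh : 0 <= h <= h by rewrite lexx ltW.
have dfv s : 0 <= s <= h -> differentiable (fun y => f (y + h *: v)) (x + s *: u).
  by move=> sh; apply: differentiable_translate; exact: df.
have df0 s : 0 <= s <= h -> differentiable f (x + s *: u).
  by move=> sh; have := df s 0 sh h0h; rewrite scale0r addr0.
have [s sh /= ->] := @MVT_line ((fun y => f (y + h *: v)) - f) x u h h0
  (fun s sh => differentiableB (dfv s sh) (df0 s sh)).
rewrite deriveB; [|exact/diff_derivable/dfv|exact/diff_derivable/df0].
rewrite derive_translate.
have [t th ->] := @MVT_line ('D_u f) (x + s *: u) v h h0 (fun t => ddf s t sh).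
by exists s, t.
Qed.

(** The second difference over a small parallelogram is h^2 times a value near [x] of
    either mixed derivative; continuity makes both values close to the values at [x]. *)
Lemma derive_comm_real f x u v :
  (\near x, differentiable f x) ->
  (\near x, differentiable ('D_u f) x) -> (\near x, differentiable ('D_v f) x) ->
  {for x, continuous ('D_v ('D_u f))} -> {for x, continuous ('D_u ('D_v f))} ->
  'D_v ('D_u f) x = 'D_u ('D_v f) x.
Proof.
move=> df duf dvf cvu cuv.
apply/eqP; rewrite -subr_eq0 -normr_le0; apply/ler_addgt0Pr => e e0; rewrite add0r.
have e2 : 0 < e / 2 by rewrite divr_gt0.
have nU : \forall y \near x, [/\ differentiable f y, differentiable ('D_u f) y,
   differentiable ('D_v f) y & `|'D_v ('D_u f) x - 'D_v ('D_u f) y| < e / 2 /\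
   `|'D_u ('D_v f) x - 'D_u ('D_v f) y| < e / 2].
  have n1 : \forall y \near x, `|'D_v ('D_u f) x - 'D_v ('D_u f) y| < e / 2.
    by move/cvgrPdist_lt : cvu => /(_ _ e2).
  have n2 : \forall y \near x, `|'D_u ('D_v f) x - 'D_u ('D_v f) y| < e / 2.
    by move/cvgrPdist_lt : cuv => /(_ _ e2).
  apply: filterS (filterI df (filterI (filterI duf dvf) (filterI n1 n2))).
  by move=> y [? [[? ?] [? ?]]].
have /nbhs_ballP[r /= r0 rU] := nU.
(* the parallelogram with sides h u and h v stays in the ball of radius r *)
pose h := r / 2 / (1 + `|u| + `|v|).
have d0 : 0 < 1 + `|u| + `|v| by rewrite -addrA ltr_wpDr.
have h0 : 0 < h by rewrite !divr_gt0.
have xU s t : 0 <= s <= h -> 0 <= t <= h -> ball x r (x + s *: u + t *: v).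
  move=> /andP[s0 sh] /andP[t0 th]; rewrite -ball_normE /= -addrA opprD addNKr -normrN opprK.
  apply: (le_lt_trans (ler_normD _ _)); rewrite !normrZ !ger0_norm //.
  apply: (@le_lt_trans _ _ (h * (1 + `|u| + `|v|))).
    have := ler_wpM2r (normr_ge0 u) sh; have := ler_wpM2r (normr_ge0 v) th; nra.
  by rewrite /h divfK ?gt_eqF //; lra.
have [s [t [sh th e1]]] := @second_difference f x u v h h0
  (fun s t sh th => let: And4 a b c d := rU _ (xU s t sh th) in a)
  (fun s t sh th => let: And4 a b c d := rU _ (xU s t sh th) in b).
have xU' s' t' : 0 <= s' <= h -> 0 <= t' <= h -> ball x r (x + s' *: v + t' *: u).
  by move=> *; rewrite addrAC; exact: xU.
have [s' [t' [sh' th' e2']]] := @second_difference f x v u h h0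
  (fun s t sh th => let: And4 a b c d := rU _ (xU' s t sh th) in a)
  (fun s t sh th => let: And4 a b c d := rU _ (xU' s t sh th) in c).
have [_ _ _ [b1 _]] := rU _ (xU s t sh th).
have [_ _ _ [_ b2]] := rU _ (xU' s' t' sh' th').
have e3 : 'D_v ('D_u f) (x + s *: u + t *: v) = 'D_u ('D_v f) (x + s' *: v + t' *: u).
  apply: (mulfI (lt0r_neq0 h0)); apply: (mulfI (lt0r_neq0 h0)).
  have sw (a b c d : R) : (a - b) - (c - d) = (a - c) - (b - d) by ring.
  apply: etrans (esym e1) _; apply: etrans (sw _ _ _ _) _.
  rewrite [x + h *: u + h *: v]addrAC; exact: e2'.
rewrite e3 in b1.
have tri (a b m : R) : `|a - m| < e / 2 -> `|b - m| < e / 2 -> `|a - b| <= e.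
  move=> am bm; apply/ltW; rewrite -(subrKA m) (splitr e).
  by apply: (le_lt_trans (ler_normD _ _)); rewrite ltrD // distrC.
exact: tri b1 b2.
Qed.
End Schwarz.

(** The real case is applied to each coordinate, which commutes with derivatives
    only near [x], whence the detours through neighbourhoods. *)
Lemma Coo_derive_comm (R : realType) p q (U : set 'rV[R]_p) (F : 'rV[R]_p -> 'rV[R]_q) x u v :
  open U -> U x -> Coo U F -> 'D_v ('D_u F) x = 'D_u ('D_v F) x.
Proof.
move=> oU Ux CF.
have dco (G : 'rV[R]_p -> 'rV[R]_q) y j : differentiable G y -> differentiable (fun y => G y 0 j) y.
  move=> dG; apply: (@differentiable_comp _ _ _ _ G (fun M : 'rV[R]_q => M 0 j)) => //.
  exact: differentiable_coord.
have Dco (G : 'rV[R]_p -> 'rV[R]_q) y w j : differentiable G y ->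
    'D_w (fun y => G y 0 j) y = 'D_w G y 0 j.
  by move=> dG; rewrite derive_mx ?mxE //; exact: diff_derivable.
have cco (G : 'rV[R]_p -> 'rV[R]_q) y j : Coo U G -> U y -> {for y, continuous (fun y => G y 0 j)}.
  by move=> CG Uy; apply: differentiable_continuous; apply/dco/(Coo_diff CG).
have DDco w y j : U y -> \forall z \near y, 'D_w (fun y => F y 0 j) z = 'D_w F z 0 j.
  by move=> Uy; apply: (open_near oU Uy) => z Uz; apply: Dco; exact: Coo_diff CF Uz.
have D2 w w' y j : U y -> 'D_w ('D_w' (fun y => F y 0 j)) y = 'D_w ('D_w' F) y 0 j.
  move=> Uy; rewrite (near_eq_derive _ (DDco w' y j Uy)) Dco //.
  exact: Coo_diff (Coo_derive _ CF) Uy.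
apply/rowP => j.
apply: etrans (esym (D2 v u x j Ux)) _.
apply: etrans _ (D2 u v x j Ux).
apply: (@derive_comm_real R _ (fun y => F y 0 j) x u v).
- by apply: (open_near oU Ux) => y Uy; apply/dco/(Coo_diff CF).
- apply: (open_near oU Ux) => y Uy.
  apply: (@differentiable_near_eq _ _ _ (fun z => 'D_u F z 0 j)).
    by have := DDco u y j Uy; apply: filterS => z ->.
  exact/dco/(Coo_diff (Coo_derive u CF)).
- apply: (open_near oU Ux) => y Uy.
  apply: (@differentiable_near_eq _ _ _ (fun z => 'D_v F z 0 j)).
    by have := DDco v y j Uy; apply: filterS => z ->.
  exact/dco/(Coo_diff (Coo_derive v CF)).
- have c := cco _ _ j (Coo_derive v (Coo_derive u CF)) Ux.
  rewrite /prop_for /continuous_at (D2 _ _ _ _ Ux).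
  apply: cvg_trans c; apply: near_eq_cvg; first exact: nbhs_filter.
  by apply: (open_near oU Ux) => y Uy; rewrite (D2 _ _ _ _ Uy).
- have c := cco _ _ j (Coo_derive u (Coo_derive v CF)) Ux.
  rewrite /prop_for /continuous_at (D2 _ _ _ _ Ux).
  apply: cvg_trans c; apply: near_eq_cvg; first exact: nbhs_filter.
  by apply: (open_near oU Ux) => y Uy; rewrite (D2 _ _ _ _ Uy).
Qed.

(** * Linear algebra of a Euclidean space *)

(** Hides compositions, so that identities between endomorphisms become identities
    in an abelian group. *)
Ltac gen_comp := repeat match goal with |- context [@comp_lfun ?R ?a ?b ?c ?f ?g] =>
  let h := fresh "cmp" in set h := (@comp_lfun R a b c f g); clearbody h end.
(** Reduces a linear identity between vectors to one between scalars: [f] ranges over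
    the coordinates. *)
Lemma vect_ext (R : realType) (W : vectType R) (a b : W) :
  (forall f : W -> R, (forall x y, f (x + y) = f x + f y) ->
     (forall x, f (- x) = - f x) -> (forall c x, f (c *: x) = c * f x) ->
     f 0 = 0 -> f a = f b) -> a = b.
Proof.
move=> h; apply: v2r_inj; apply/rowP => i.
apply: (h (fun x => v2r x 0 i)) => [x y|x|c x|]; rewrite ?(linearD, linearN, linearZ) ?linear0 ?mxE //.
Qed.
Ltac vring := gen_comp;
  let f := fresh "func" in let fD := fresh "fD" in let fN := fresh "fN" in
  let fZ := fresh "fZ" in let f0 := fresh "f0" in
  apply: vect_ext => f fD fN fZ f0; rewrite ?(fD,fN,fZ,f0); clear fD fN fZ f0;
  repeat match goal with |- context [f ?x] =>
    let h := fresh "at" in set h := (f x); clearbody h end; ring.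

Definition lfun_compE := (comp_lfunDl, comp_lfunDr, comp_lfunNl, comp_lfunNr, comp_lfunA,
  comp_lfun1l, comp_lfun1r, comp_lfun0l, comp_lfun0r).

Section Metric.
Context {R : realType} {V : vectType R}.
Variable g : {dot V for idfun}.
Implicit Types (A B K X : 'End(V)) (u v w : V).

Lemma metricC u v : g u v = g v u. Proof. by rewrite hermC expr0 mul1r. Qed.
Lemma metric_gt0 u : u != 0 -> 0 < g u u. Proof. exact: neq0_dnorm_gt0. Qed.
Lemma metric_eq0 u : (g u u == 0) = (u == 0).
Proof.
apply/idP/idP => [|/eqP ->]; last by rewrite linear0r.
by apply: contraTT => /metric_gt0; rewrite lt0r => /andP[].
Qed.
Lemma metricZl a u v : g (a *: u) v = a * g u v. Proof. exact: linearZl_LR. Qed.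
Lemma metricZr a u v : g u (a *: v) = a * g u v.
Proof. by rewrite metricC metricZl metricC. Qed.
Lemma metricDl u v w : g (u + v) w = g u w + g v w. Proof. exact: linearDl. Qed.
Lemma metricDr u v w : g w (u + v) = g w u + g w v. Proof. exact: linearDr. Qed.
Lemma metricNl u v : g (- u) v = - g u v. Proof. exact: linearNl. Qed.
Lemma metricNr u v : g v (- u) = - g v u. Proof. exact: linearNr. Qed.
Definition metricE := (metricDl, metricDr, metricNl, metricNr, metricZl, metricZr).

(** Adjunction as a relation: adjoints are always known explicitly below, so that no
    adjoint operator has to be constructed. *)
Definition adjoint A B := forall u v, g (A u) v = g u (B v).

Lemma adjointC A B : adjoint A B -> adjoint B A.
Proof. by move=> h u v; rewrite metricC -h metricC. Qed.
Lemma adjointM A A' B B' : adjoint A A' -> adjoint B B' ->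
  adjoint (A \o B)%VF (B' \o A')%VF.
Proof. by move=> hA hB u v; rewrite !comp_lfunE hA hB. Qed.
Lemma adjointD A A' B B' : adjoint A A' -> adjoint B B' -> adjoint (A + B) (A' + B').
Proof. by move=> hA hB u v; rewrite !lfunE /= linearDl linearDr /= hA hB. Qed.
Lemma adjointN A A' : adjoint A A' -> adjoint (- A) (- A').
Proof. by move=> hA u v; rewrite !lfunE /= linearNl linearNr /= hA. Qed.
Lemma adjointZ a A A' : adjoint A A' -> adjoint (a *: A) (a *: A').
Proof. by move=> hA u v; rewrite !lfunE /= metricZl metricZr hA. Qed.
Lemma adjoint1 : adjoint \1%VF \1%VF. Proof. by move=> u v; rewrite !lfunE. Qed.
(** Skewness as an instance of [adjoint], so that the calculus of adjoints proves all
    skewness statements. *)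
Lemma oVP A : oV g A <-> adjoint A (- A).
Proof. by split=> h u v; rewrite ?opp_lfunE ?linearNr /= h // opp_lfunE linearNr. Qed.

Lemma oVD A B : oV g A -> oV g B -> oV g (A + B).
Proof. by move=> /oVP a /oVP b; apply/oVP; rewrite opprD; exact: adjointD. Qed.
Lemma oVN A : oV g A -> oV g (- A).
Proof. by move=> /oVP a; apply/oVP; exact: adjointN. Qed.
Lemma oVZ c A : oV g A -> oV g (c *: A).
Proof. by move=> /oVP a; apply/oVP; rewrite -scalerN; exact: adjointZ. Qed.
Lemma oV0 : oV g 0.
Proof. by rewrite -(scale0r 0); apply: oVZ => u v; rewrite !lfunE /= linear0l linear0r oppr0. Qed.

Lemma twistor_oV K : twistor g K -> oV g K.
Proof.
move=> [K2 iK] u v; rewrite -iK -comp_lfunE K2 opp_lfunE lfunE /= linearNl //.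
Qed.
Lemma twistorN K : twistor g K -> twistor g (- K).
Proof.
move=> [K2 iK]; split; first by rewrite !lfun_compE opprK.
by move=> u v; rewrite !opp_lfunE linearNl linearNr /= opprK.
Qed.

(** Cayley transform *)
(** g(Bv, v) vanishes for [B] skew, so (1 + B)v = 0 forces g(v, v) = 0. *)
Lemma lker_skew B : oV g B -> lker (\1%VF + B) == 0%VS.
Proof.
move=> sB; rewrite -subv0; apply/subvP => v; rewrite memv_ker memv0 => /eqP.
rewrite add_lfunE lfunE /= => /eqP; rewrite addr_eq0 => /eqP vB.
rewrite -metric_eq0; have e : g (B v) v = 0.
  by have := sB v v; rewrite [g v _]metricC => e; lra.
by rewrite {1}vB linearNl /= e oppr0.
Qed.

(** As [B] anti-commutes with [K], conjugation by M = 1 + B sends [K] to K N M^-1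
    with N = 1 - B the adjoint of [M]; N M^-1 is an isometry because [M] and [N] commute. *)
Lemma cayley_twistor K B : twistor g K -> oV g B -> (B \o K)%VF = - (K \o B)%VF ->
  twistor g ((\1%VF + B) \o K \o (\1%VF + B)^-1)%VF.
Proof.
move=> tK sB BK; have [K2 iK] := tK; have kM := lker_skew sB.
have kN : lker (\1%VF - B) == 0%VS by apply/lker_skew/oVN.
set M := \1%VF + B in kM *; set N := \1%VF - B in kN.
have NK : (N \o K = K \o M)%VF by rewrite /N /M !lfun_compE BK opprK.
have NM : (N \o M = M \o N)%VF by rewrite /N /M !lfun_compE; vring.
have ad : adjoint M N by apply: adjointD; [exact: adjoint1|exact/oVP].
split.
  rewrite !comp_lfunA (lker0_compfVK kM) -(comp_lfunA M K K) K2.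
  by rewrite comp_lfunNr comp_lfunNl comp_lfun1r lker0_compfV.
have MK : (M \o K = K \o N)%VF by rewrite /N /M !lfun_compE BK.
move=> u v; rewrite MK !comp_lfunE.
have [u' ->] : exists u', u = M u' by exists (M^-1%VF u); rewrite lker0_lfunVK.
have [v' ->] : exists v', v = M v' by exists (M^-1%VF v); rewrite lker0_lfunVK.
rewrite !lker0_lfunK // iK (adjointC ad) -comp_lfunE -NM comp_lfunE.
by rewrite -ad.
Qed.

End Metric.

(** * Inverting endomorphisms that depend on a parameter *)

Section InverseCalculus.
Context {R : realType} {V : vectType R}.

Lemma f2mx_linear : linear (@f2mx R V V).
Proof.
move=> a f h; rewrite -[RHS]/(f2mx (Hom _)); congr (f2mx _).
by apply/lfunP => v; rewrite lfunE /= scale_lfunE unlock /= -!linearP.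
Qed.
HB.instance Definition _ := GRing.isLinear.Build R 'End(V) 'M[R]_(dim V) _ (@f2mx R V V) f2mx_linear.

Lemma f2mx_inj : injective (@f2mx R V V).
Proof. by case=> A [] B /= ->. Qed.

Lemma Hom_linear : linear (@Hom R V V).
Proof. by move=> a A B; apply: f2mx_inj; rewrite linearP. Qed.
HB.instance Definition _ := GRing.isLinear.Build R 'M[R]_(dim V) 'End(V) _ (@Hom R V V) Hom_linear.

Lemma lker0_unit (f : 'End(V)) : (lker f == 0%VS) = (f2mx f \in unitmx).
Proof. by rewrite -dimv_eq0 /dimv /= mxrank_gen mxrank_eq0 kermx_eq0 row_free_unit. Qed.

Lemma inv_lfunE (f : 'End(V)) : lker f == 0%VS -> (f^-1)%VF = Hom (invmx (f2mx f)).
Proof. by rewrite lker0_unit => fu; rewrite /inv_lfun pinvmxE. Qed.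

(** Injectivity is the non-vanishing of a determinant, a continuous function of [x]. *)
Lemma open_lker0 p (G : {linear 'rV[R]_p -> 'End(V)}) (c : 'End(V)) :
  open [set x | lker (c + G x) == 0%VS].
Proof.
rewrite (_ : [set x | _] = (fun x => \det (f2mx (c + G x))) @^-1` [set y | y != 0]); last first.
  by apply/seteqP; split=> x /=; rewrite lker0_unit unitmxE unitfE.
apply: open_comp; last exact: open_neq.
have cf a b : continuous (fun x => f2mx (c + G x) a b).
  have -> : (fun x => f2mx (c + G x) a b) = cst (f2mx c a b) + (fun x => f2mx (G x) a b).
    by apply/funext => x; rewrite !fctE linearD mxE.
  move=> x; apply: cvgD; [exact: nbhs_filter|exact: cst_continuous|].
  pose L := fun x => f2mx (G x) a b : R^o.
  have lL : linear L by move=> k y z; rewrite /L !linearP !mxE.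
  pose LL : {linear 'rV[R]_p -> R^o} := HB.pack L (GRing.isLinear.Build R _ _ _ L lL).
  exact: (@linear_row_continuous _ _ _ LL).
move=> x _; apply: continuous_sumr => s {}x; apply: cvgM; [exact: nbhs_filter|exact: cst_continuous|].
move: x; apply: continuous_big; first exact: mul_continuous.
by move=> i _; exact: cf.
Qed.

(** Cramer's rule: the entries of the inverse are quotients of polynomials in [t]. *)
Lemma derivable_inverse (A B : 'End(V)) :
  lker A == 0%VS ->
  derivable (fun t : R => v2r (A + t *: B)^-1%VF) 0 1.
Proof.
move=> kA.
(* the matrix of A + t B as a matrix of polynomials in t *)
pose P := \matrix_(i, j) ((f2mx A i j)%:P + (f2mx B i j) *: 'X) : 'M[{poly R}]_(dim V).
have PE t : f2mx (A + t *: B) = map_mx (horner_eval t) P.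
  apply/matrixP=> i j; rewrite linearD linearZ !mxE /horner_eval !hornerE.
  by rewrite mulrC.
have dE t : \det (f2mx (A + t *: B)) = (\det P).[t] by rewrite PE det_map_mx.
have d0 : (\det P).[0] != 0.
  by rewrite -dE -unitfE -unitmxE -lker0_unit scale0r addr0.
have cd : {for 0, continuous (fun t => (\det P).[t])}.
  exact: continuous_horner.
have nd : \forall t \near (0 : R), (\det P).[t] != 0.
  have o0 : nbhs (\det P).[0] [set y : R | y != 0].
    by apply: open_nbhs_nbhs; split; [exact: open_neq|exact: d0].
  exact: (cd _ o0).
pose h t : 'rV[R]_(dim 'End(V)) := v2r (Hom (((\det P).[t])^-1 *: map_mx (horner_eval t) (\adj P))).
apply: (@near_eq_derivable _ _ _ h).
  apply: filterS nd => t dt; rewrite /h; congr (v2r _).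
  have u : f2mx (A + t *: B) \in unitmx by rewrite unitmxE unitfE dE.
  by rewrite inv_lfunE ?lker0_unit // /invmx u dE PE map_mx_adj.
pose L := fun M : 'M[R]_(dim V) => v2r (Hom M).
have lL : linear L by move=> a y z; rewrite /L !linearP.
pose LL : {linear 'M[R]_(dim V) -> 'rV[R]_(dim 'End(V))} := HB.pack L (GRing.isLinear.Build R _ _ _ L lL).
have -> : h = fun t => \sum_i \sum_j ((\det P).[t]^-1 * (\adj P i j).[t]) *: LL (delta_mx i j).
  apply/funext=> t; rewrite /h -[LHS]/(LL _) {1}[_ *: map_mx _ _]matrix_sum_delta linear_sum.
  by apply: eq_bigr => i _; rewrite linear_sum; apply: eq_bigr => j _; rewrite linearZ !mxE.
pose k i j (t : R) := ((\det P).[t]^-1 * (\adj P i j).[t]) *: LL (delta_mx i j).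
suff dk i j : derivable (k i j) 0 1.
  have -> : (fun t => \sum_i \sum_j ((\det P).[t]^-1 * (\adj P i j).[t]) *: LL (delta_mx i j))
   = \sum_i \sum_j k i j.
    by apply/funext=> t; rewrite fct_sumE; apply: eq_bigr => i _; rewrite fct_sumE.
  by apply: derivable_sum => i; apply: derivable_sum => j; exact: dk.
apply/derivable_mxP => a b.
have -> : (fun x => k i j x a b) = (fun t => (\det P).[t]^-1 * (\adj P i j).[t]) * cst (LL (delta_mx i j) a b).
  by apply/funext=> t; rewrite /k mxE.
apply: derivableM; last exact: derivable_cst.
apply: derivableM; last exact: derivable_horner.
by apply: derivableV => //; exact: derivable_horner.
Qed.
End InverseCalculus.

(** * Derivatives along the twistor space *)

(** Bilinearity between vector spaces that carry no topology; [row_bilin] moves such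
    a map to coordinates, where the calculus lives. *)
Definition bilin (R : realType) (U V W : vectType R) (b : U -> V -> W) : Prop :=
  (forall a x x' y, b (a *: x + x') y = a *: b x y + b x' y) /\
  (forall a x y y', b x (a *: y + y') = a *: b x y + b x y').

Section RowLift.
Context {R : realType} {U V W : vectType R}.

Lemma row_bilin (b : U -> V -> W) : bilin b ->
  exists bb : {bilinear 'rV[R]_(dim U) -> 'rV[R]_(dim V) -> 'rV[R]_(dim W)},
    forall x y, bb x y = v2r (b (r2v x) (r2v y)).
Proof.
move=> [bl br]; pose B x y := v2r (b (r2v x) (r2v y)).
have B1 : forall y, linear (B^~ y) by move=> y a x x'; rewrite /B linearP bl linearP.
have B2 : forall x, linear (B x) by move=> x a y y'; rewrite /B linearP br linearP.
pose BB : {bilinear 'rV[R]_(dim U) -> 'rV[R]_(dim V) -> 'rV[R]_(dim W)} :=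
  HB.pack B (bilinear_isBilinear.Build R _ _ _ _ _ B (B1, B2)).
by exists BB.
Qed.

Lemma row_linear (l : {linear U -> W}) :
  exists ll : {linear 'rV[R]_(dim U) -> 'rV[R]_(dim W)},
    forall x, ll x = v2r (l (r2v x)).
Proof.
pose L x := v2r (l (r2v x)).
have lL : linear L by move=> a y z; rewrite /L !linearP.
pose LL : {linear 'rV[R]_(dim U) -> 'rV[R]_(dim W)} :=
  HB.pack L (GRing.isLinear.Build R _ _ _ L lL).
by exists LL.
Qed.
End RowLift.

Lemma bilin_comp (R : realType) (V : vectType R) :
  bilin (fun A B : 'End(V) => (A \o B)%VF).
Proof.
by split=> a x y z; rewrite ?comp_lfunDl ?comp_lfunDr -?comp_lfunZl -?comp_lfunZr.
Qed.

Section TwistorCalculus.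
Context {R : realType} {V : vectType R}.
Variable g : {dot V for idfun}.
Implicit Types (K : twistor g) (W : vectType R).

Lemma phiP K : twistor g (phi K). Proof. exact: set_valP. Qed.

Lemma twistor_point A : twistor g A -> exists K, phi K = A.
Proof. by move=> tA; exists (SigSub (mem_set tA)). Qed.

(** The curve is t |-> (1 + tB) K (1 + tB)^-1, whose velocity at 0 is [B, K]; it stays
    in the twistor space when [B] is skew and anti-commutes with [K].  Since X K K = - X
    and [X] anti-commutes with [K], B = - X K / 2 has [B, K] = X. *)
Lemma twistor_curve K X : tangent K X ->
  exists c : R -> twistor g, [/\ c 0 = K,
    differentiable (fun t => v2r (phi (c t))) 0 &
    'D_1 (fun t => v2r (phi (c t))) 0 = v2r X].
Proof.
move=> [sX aX]; have tK := phiP K; have [K2 _] := tK; have sK := twistor_oV tK.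
set k := phi K in aX tK K2 sK *.
have Xk : (X \o k)%VF = - (k \o X)%VF by apply/eqP; rewrite -addr_eq0; exact/eqP.
pose B := - 2^-1 *: (X \o k)%VF.
have sB : oV g B.
  apply: oVZ; apply/oVP; rewrite {2}Xk opprK.
  have := adjointM (proj1 (oVP g X) sX) (proj1 (oVP g k) sK).
  by rewrite comp_lfunNl comp_lfunNr opprK.
have Bk : (B \o k)%VF = - (k \o B)%VF.
  by rewrite /B -comp_lfunZl -comp_lfunZr -scalerN [(k \o (X \o k))%VF]comp_lfunA -comp_lfunNl -Xk.
have stB t : oV g (t *: B) by exact: oVZ.
have tc t : twistor g ((\1%VF + t *: B) \o k \o (\1%VF + t *: B)^-1)%VF.
  by apply: cayley_twistor => //; rewrite -comp_lfunZl -comp_lfunZr Bk scalerN.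
pose c t : twistor g := SigSub (mem_set (tc t)).
have phic t : phi (c t) = ((\1%VF + t *: B) \o k \o (\1%VF + t *: B)^-1)%VF by [].
have k1 t : lker (\1%VF + t *: B) == 0%VS by exact: lker_skew.
pose m t := v2r (\1%VF + t *: B).
pose i t := v2r (\1%VF + t *: B)^-1%VF.
have k0 : lker (\1%VF : 'End(V)) == 0%VS by apply/lker0P => x y; rewrite !lfunE.
have di : differentiable i 0 by apply/derivable1_diffP; exact: derivable_inverse.
have mE : m = cst (v2r \1%VF) + (fun t => t *: v2r B).
  by apply/funext=> t; rewrite /m !fctE linearD linearZ.
have dm : is_derive (0 : R) 1 m (v2r B).
  have D : is_derive (0 : R) 1 (fun t : R => t *: v2r B) (v2r B).
    have ds : is_diff (0 : R) (fun t : R => t *: v2r B) (fun t : R => t *: v2r B).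
      exact: is_diff_scalel.
    split; first by apply/derivable1_diffP; case: ds.
    by rewrite deriveE; case: ds => // _ ->; rewrite scale1r.
  by rewrite mE -[X in is_derive _ _ _ X]add0r; exact: is_deriveD.
have [dm1 Dm] := dm.
have dm' : differentiable m 0 by exact/derivable1_diffP.
have [b bE] := row_bilin (@bilin_comp R V).
have bE' A A' : b (v2r A) (v2r A') = v2r (A \o A')%VF by rewrite bE !v2rK.
have i0 : i 0 = v2r \1%VF.
  rewrite /i scale0r addr0; congr (v2r _).
  by rewrite -[LHS]comp_lfun1l lker0_compfV.
have m0 : m 0 = v2r \1%VF by rewrite /m scale0r addr0.
(* differentiate (1 + tB)(1 + tB)^-1 = 1 at t = 0 *)
have Di : 'D_1 i 0 = - v2r B.
  have e : (fun t => b (m t) (i t)) = cst (v2r \1%VF).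
    by apply/funext=> t; rewrite bE' lker0_compfV.
  have := @derive_bilinear R R _ _ _ b m i 0 1 dm' di; rewrite e derive_cst i0 m0 /=.
  rewrite Dm.
  rewrite -(r2vK ('D_1 i 0)) !bE' comp_lfun1l comp_lfun1r => /eqP.
  by rewrite eq_sym addrC addr_eq0 => /eqP ->.
have cE : (fun t => v2r (phi (c t))) = fun t => b (b (m t) (v2r k)) (i t).
  by apply/funext=> t; rewrite !bE' phic.
have dk : differentiable (fun t : R => v2r k) 0 by exact: differentiable_cst.
have dmk : differentiable (fun t => b (m t) (v2r k)) 0.
  exact: (@differentiable_bilinear _ _ _ _ _ b m (fun=> v2r k)).
exists c; split.
- by apply: val_inj; rewrite /= -/(phi K) -/k scale0r addr0 comp_lfun1l -[RHS]comp_lfun1r -[in RHS](lker0_compfV k0) comp_lfun1l.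
- by rewrite cE; exact: (@differentiable_bilinear _ _ _ _ _ b (fun t => b (m t) (v2r k)) i).
rewrite cE (@derive_bilinear R R _ _ _ b _ i 0 1 dmk di) (@derive_bilinear R R _ _ _ b m _ 0 1 dm' dk) Di i0 m0.
rewrite derive_cst; rewrite Dm.
rewrite -linearN linear0r /= addr0 !bE' -linearD; congr (v2r _).
rewrite comp_lfun1r comp_lfun1l comp_lfunNr -Bk.
rewrite /B -!comp_lfunZl -!comp_lfunA K2 comp_lfunNr comp_lfun1r.
by rewrite scaleNr scalerN opprK -scalerDl; rewrite (_ : 2^-1 + 2^-1 = 1) ?scale1r //; field.
Qed.
End TwistorCalculus.

Section DerivationRules.
Context {R : realType} {V : vectType R}.
Variable g : {dot V for idfun}.
Implicit Types (K : twistor g) (X Y : 'End(V)).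
Notation pt K := (v2r (phi K)).

Lemma derive_linear_dir (p q : nat) (F : 'rV[R]_p -> 'rV[R]_q) x a u v :
  differentiable F x -> 'D_(a *: u + v) F x = a *: 'D_u F x + 'D_v F x.
Proof. by move=> dF; rewrite (deriveE _ dF) linearP -!(deriveE _ dF). Qed.

(** The right side does not mention the extension [F]. *)
Lemma local_ext_curve (W : vectType R) (f : twistor g -> W) K X F (c : R -> twistor g) :
  local_ext f K F -> c 0 = K -> differentiable (fun t => pt (c t)) 0 ->
  'D_1 (fun t => pt (c t)) 0 = v2r X ->
  'D_(v2r X) F (pt K) = 'D_1 (fun t => v2r (f (c t))) 0.
Proof.
move=> [U [[oU UK] CF FE]] c0 dc Dc.
have dF : differentiable F ((fun t => pt (c t)) 0) by rewrite c0; exact: Coo_diff CF UK.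
transitivity ('D_1 (F \o (fun t => pt (c t))) 0).
  rewrite [RHS]deriveE; last exact: differentiable_comp.
  have /= -> := congr1 (@^~ 1) (diff_comp dc dF).
  rewrite -(deriveE _ dc) Dc c0 deriveE //; exact: Coo_diff CF UK.
apply: near_eq_derive.
have : \forall t \near (0 : R), U (pt (c t)).
  have cc := differentiable_continuous dc.
  have nU : nbhs (pt (c 0)) U by rewrite c0; exact: open_nbhs_nbhs.
  exact: (cc _ nU).
by apply: filterS => t /FE.
Qed.

(** [dT] is computed on an arbitrary extension; all of them have the same derivative
    along a curve in the twistor space with velocity [X]. *)
Lemma dT_ext (W : vectType R) (f : twistor g -> W) K X F :
  local_ext f K F -> tangent K X -> v2r (dT f K X) = 'D_(v2r X) F (pt K).
Proof.
move=> eF tX; have [c [c0 dc Dc]] := twistor_curve tX.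
rewrite /dT r2vK (local_ext_curve eF c0 dc Dc) (@local_ext_curve _ f K X _ c) //.
by apply: xgetPex; exists F.
Qed.

Lemma dT_linear_dir (W : vectType R) (f : twistor g -> W) K a X Y : smooth_at f K ->
  dT f K (a *: X + Y) = a *: dT f K X + dT f K Y.
Proof.
move=> sf; rewrite /dT; have [U [[oU UK] CF _]] := xgetPex (fun=> 0) sf.
by rewrite linearP derive_linear_dir ?linearP //; exact: Coo_diff CF UK.
Qed.

Lemma local_ext_diff (W : vectType R) (f : twistor g -> W) K F : local_ext f K F -> differentiable F (pt K).
Proof. by move=> [U [[oU UK] CF FE]]; exact: Coo_diff CF UK. Qed.

Section Rules.
Context {W W1 W2 W3 : vectType R}.

Lemma local_ext_cst (w : W) K : local_ext (fun=> w) K (cst (v2r w)).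
Proof. by exists setT; split=> // [|m]; [split=> //; exact: openT|exact: Cm_cst]. Qed.

Lemma smooth_cst (w : W) : smooth (fun _ : twistor g => w).
Proof. by move=> K; exists (cst (v2r w)); exact: local_ext_cst. Qed.

Lemma dT_cst (w : W) K X : tangent K X -> dT (fun _ : twistor g => w) K X = 0.
Proof.
move=> tX; apply: v2r_inj; rewrite (dT_ext (local_ext_cst w K) tX).
by rewrite derive_cst linear0.
Qed.

Lemma Coo_id p U : Coo U (@id 'rV[R]_p).
Proof.
case=> [|m] /=; first by move=> x _; exact: cvg_id.
split=> [x _|v]; first by [].
rewrite (_ : (fun _ => _) = cst v); first exact: Cm_cst.
by apply/funext=> x; rewrite derive_id.
Qed.

Lemma local_ext_phi K : local_ext (@phi _ _ g) K id.
Proof. by exists setT; split=> //; [split=> //; exact: openT|exact: Coo_id]. Qed.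

Lemma smooth_phi : smooth (@phi _ _ g).
Proof. by move=> K; exists id; exact: local_ext_phi. Qed.

Lemma dT_phi K X : tangent K X -> dT (@phi _ _ g) K X = X.
Proof. by move=> tX; apply: v2r_inj; rewrite (dT_ext (local_ext_phi K) tX) derive_id. Qed.

Lemma local_extD (f h : twistor g -> W) K F H : local_ext f K F -> local_ext h K H ->
  local_ext (fun K => f K + h K) K (F + H).
Proof.
move=> [U [[oU UK] CF FE]] [U' [[oU' UK'] CH HE]].
have oI : open (U `&` U') by exact: openI.
exists (U `&` U'); split=> // [m|K' [u u']].
  by apply: CmD => //; [apply: sub_Cm (CF m) => x []|apply: sub_Cm (CH m) => x []].
by rewrite fctE FE // HE // linearD.
Qed.

Lemma smoothD (f h : twistor g -> W) : smooth f -> smooth h -> smooth (fun K => f K + h K).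
Proof.
move=> sf sh K; have [F eF] := sf K; have [H eH] := sh K.
by exists (F + H); exact: local_extD.
Qed.

Lemma dTD (f h : twistor g -> W) K X : smooth f -> smooth h -> tangent K X ->
  dT (fun K => f K + h K) K X = dT f K X + dT h K X.
Proof.
move=> sf sh tX; have [F eF] := sf K; have [H eH] := sh K.
apply: v2r_inj; rewrite [in RHS]linearD /= (dT_ext (local_extD eF eH) tX) (dT_ext eF tX) (dT_ext eH tX).
have dF : derivable F (pt K) (v2r X) by exact/diff_derivable/(local_ext_diff eF).
have dH : derivable H (pt K) (v2r X) by exact/diff_derivable/(local_ext_diff eH).
exact: deriveD dF dH.
Qed.

Section Linear.
Variables (l : {linear W1 -> W}) (f : twistor g -> W1).

Lemma smooth_linear_dT : smooth f -> smooth (fun K => l (f K)) /\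
  forall K X, tangent K X -> dT (fun K => l (f K)) K X = l (dT f K X).
Proof.
have [ll lE] := row_linear l.
have e K F : local_ext f K F -> local_ext (fun K => l (f K)) K (ll \o F).
  move=> [U [[oU UK] CF FE]]; exists U; split=> //; first exact: Coo_linear.
  by move=> K' u /=; rewrite FE // lE v2rK.
move=> sf; split=> [K|K X tX]; have [F eF] := sf K.
  by exists (ll \o F); exact: e.
apply: v2r_inj; rewrite (dT_ext (e _ _ eF) tX) derive_linear; last exact: local_ext_diff eF.
by rewrite -(dT_ext eF tX) lE v2rK.
Qed.
Lemma smooth_linear : smooth f -> smooth (fun K => l (f K)).
Proof. by case/smooth_linear_dT. Qed.
Lemma dT_linear K X : smooth f -> tangent K X -> dT (fun K => l (f K)) K X = l (dT f K X).
Proof. by case/smooth_linear_dT => _; exact. Qed.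
End Linear.

Section Bilinear.
Variables (b : W1 -> W2 -> W3) (bP : bilin b).
Variables (f : twistor g -> W1) (h : twistor g -> W2).

(** Smoothness and the product rule share one construction, the extension of the
    product by the product of the extensions. *)
Lemma smooth_bilin_dT : smooth f -> smooth h -> smooth (fun K => b (f K) (h K)) /\
  forall K X, tangent K X ->
    dT (fun K => b (f K) (h K)) K X = b (dT f K X) (h K) + b (f K) (dT h K X).
Proof.
have [bb bE] := row_bilin bP.
have e K F H : local_ext f K F -> local_ext h K H ->
   local_ext (fun K => b (f K) (h K)) K (fun x => bb (F x) (H x)).
  move=> [U [[oU UK] CF FE]] [U' [[oU' UK'] CH HE]].
  have oI : open (U `&` U') by exact: openI.
  exists (U `&` U'); split=> //.
    apply: Coo_bilinear => // m.
      by apply: sub_Cm (CF m) => x [].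
    by apply: sub_Cm (CH m) => x [].
  by move=> K' [u u'] /=; rewrite FE // HE // bE !v2rK.
move=> sf sh; split=> [K|K X tX]; have [F eF] := sf K; have [H eH] := sh K.
  by exists (fun x => bb (F x) (H x)); exact: e.
apply: v2r_inj; rewrite (dT_ext (e _ _ _ eF eH) tX).
rewrite (derive_bilinear _ _ (local_ext_diff eF) (local_ext_diff eH)).
rewrite -(dT_ext eF tX) -(dT_ext eH tX) linearD.
have [U [[_ UK] _ ->]] := eF; rewrite //.
have [U' [[_ UK'] _ ->]] := eH; rewrite //.
by rewrite !bE !v2rK.
Qed.
Lemma smooth_bilin : smooth f -> smooth h -> smooth (fun K => b (f K) (h K)).
Proof. by move=> sf sh; case: (smooth_bilin_dT sf sh). Qed.
Lemma dT_bilin K X : smooth f -> smooth h -> tangent K X ->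
  dT (fun K => b (f K) (h K)) K X = b (dT f K X) (h K) + b (f K) (dT h K X).
Proof. by move=> sf sh; case: (smooth_bilin_dT sf sh) => _; exact. Qed.
End Bilinear.

End Rules.

Lemma bilin_scale (W : vectType R) : bilin (fun (a : R^o) (w : W) => a *: w).
Proof.
split=> a x y z; first by rewrite scalerDl scalerA.
by rewrite scalerDr !scalerA mulrC.
Qed.

Implicit Types A B : twistor g -> 'End(V).
Lemma smoothM A B : smooth A -> smooth B -> smooth (fun K => (A K \o B K)%VF).
Proof. exact: smooth_bilin (@bilin_comp R V) _ _. Qed.
Lemma dTM A B K X : smooth A -> smooth B -> tangent K X ->
  dT (fun K => (A K \o B K)%VF) K X = (dT A K X \o B K)%VF + (A K \o dT B K X)%VF.
Proof. exact: dT_bilin (@bilin_comp R V) _ _ _ _. Qed.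
Lemma smoothZ c A : smooth A -> smooth (fun K => c *: A K).
Proof. exact: (@smooth_linear _ _ (GRing.scale c) A). Qed.
Lemma dTZ c A K X : smooth A -> tangent K X -> dT (fun K => c *: A K) K X = c *: dT A K X.
Proof. exact: (@dT_linear _ _ (GRing.scale c) A). Qed.
Lemma smoothN A : smooth A -> smooth (fun K => - A K).
Proof. exact: (@smooth_linear _ _ (@GRing.opp _) A). Qed.
Lemma dTN A K X : smooth A -> tangent K X -> dT (fun K => - A K) K X = - dT A K X.
Proof. exact: (@dT_linear _ _ (@GRing.opp _) A). Qed.
Lemma smoothB A B : smooth A -> smooth B -> smooth (fun K => A K - B K).
Proof. by move=> sA sB; apply: smoothD => //; exact: smoothN. Qed.
Lemma dTB A B K X : smooth A -> smooth B -> tangent K X ->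
  dT (fun K => A K - B K) K X = dT A K X - dT B K X.
Proof. by move=> sA sB tX; rewrite dTD ?dTN //; exact: smoothN. Qed.
Lemma dTS (f : twistor g -> R^o) A K X : smooth f -> smooth A -> tangent K X ->
  dT (fun K => f K *: A K) K X = dT f K X *: A K + f K *: dT A K X.
Proof. exact: (dT_bilin (bilin_scale _)). Qed.
Lemma smooth_comm A B : smooth A -> smooth B -> smooth (fun K => commE (A K) (B K)).
Proof. by move=> sA sB; apply: smoothB; exact: smoothM. Qed.
Lemma dT_comm A B K X : smooth A -> smooth B -> tangent K X ->
  dT (fun K => commE (A K) (B K)) K X = commE (dT A K X) (B K) + commE (A K) (dT B K X).
Proof.
move=> sA sB tX; rewrite dTB ?dTM //; try exact: smoothM.
by move: (dT A K X) (dT B K X) => a b; rewrite /commE; vring.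
Qed.

End DerivationRules.

(** * The Lie bracket of vector fields *)

Section FieldDerivative.
Context {R : realType} {p q : nat}.
Implicit Types (U : set 'rV[R]_p) (F : 'rV[R]_p -> 'rV[R]_q) (Y : 'rV[R]_p -> 'rV[R]_p).

Lemma derive_coordE F x v : differentiable F x ->
  'D_v F x = \sum_i v 0 i *: 'D_(delta_mx 0 i) F x.
Proof.
move=> dF; rewrite (deriveE _ dF) {1}(row_sum_delta v) linear_sum; apply: eq_bigr => i _.
by rewrite linearZ (deriveE _ dF).
Qed.

(** Named so that the bilinear product rule applies to the expansion of a directional
    derivative along a variable direction in partial derivatives. *)
Definition coord_scale (i : 'I_p) (x : 'rV[R]_p) (y : 'rV[R]_q) := x 0 i *: y.
Lemma coord_scaleP i : bilinear_for *:%R *:%R (coord_scale i).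
Proof.
split=> y a x z; first by rewrite /coord_scale /= !mxE scalerDl scalerA.
by rewrite /coord_scale /= scalerDr !scalerA mulrC.
Qed.
HB.instance Definition _ i := bilinear_isBilinear.Build R _ _ _ *:%R *:%R (coord_scale i)
  (coord_scaleP i).

Lemma Coo_sum U n (h : 'I_n -> 'rV[R]_p -> 'rV[R]_q) : open U -> (forall i, Coo U (h i)) ->
  Coo U (\sum_i h i).
Proof.
move=> oU hC m; apply: (big_ind (Cm m U)); first exact: Cm_cst.
  by move=> *; exact: CmD.
by move=> i _; exact: hC.
Qed.

Lemma derive_along_sum U F Y x : open U -> U x -> Coo U F ->
  'D_(Y x) F x = (\sum_i (fun y => coord_scale i (Y y) ('D_(delta_mx 0 i) F y))) x.
Proof.
move=> oU Ux CF; rewrite fct_sumE derive_coordE //; exact: Coo_diff CF Ux.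
Qed.

Lemma Coo_derive_along U F Y : open U -> Coo U F -> Coo U Y ->
  Coo U (fun x => 'D_(Y x) F x).
Proof.
move=> oU CF CY m.
apply: (@eq_Cm _ _ _ _ _ (\sum_i (fun y => coord_scale i (Y y) ('D_(delta_mx 0 i) F y)))) => //.
  by move=> x Ux; rewrite -(derive_along_sum Y oU Ux CF).
apply: Coo_sum => // i.
by apply: (@Coo_bilinear R p p q q U (coord_scale i)) => //; exact: Coo_derive.
Qed.

(** In coordinates, sum_i Y_i D_i F is differentiated by the product rule; the second
    derivatives are then reordered by symmetry. *)
Lemma derive_derive_along U F Y x u : open U -> U x -> Coo U F -> Coo U Y ->
  'D_u (fun y => 'D_(Y y) F y) x = 'D_('D_u Y x) F x + 'D_(Y x) ('D_u F) x.
Proof.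
move=> oU Ux CF CY.
pose h i y := coord_scale i (Y y) ('D_(delta_mx 0 i) F y).
have dY := Coo_diff CY Ux.
have dDi (i : 'I_p) := Coo_diff (Coo_derive (delta_mx 0 i) CF) Ux.
have dh i : derivable (h i) x u.
  exact/diff_derivable/(@differentiable_bilinear R _ p q q (coord_scale i) Y _ x).
transitivity ('D_u (\sum_i h i) x).
  by apply: near_eq_derive; apply: (open_near oU Ux) => y Uy; exact: (derive_along_sum Y oU Uy CF).
rewrite derive_sum //.
rewrite (derive_coordE _ (Coo_diff CF Ux)).
rewrite (derive_coordE _ (Coo_diff (Coo_derive u CF) Ux)) -big_split /=.
apply: eq_bigr => i _.
apply: etrans (@derive_bilinear R _ p q q (coord_scale i) Y _ x u dY (dDi i)) _.
have e := @Coo_derive_comm R p q U F x (delta_mx 0 i) u oU Ux CF.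
exact: (congr1 (fun z => ('D_u Y x) 0 i *: 'D_(delta_mx 0 i) F x + Y x 0 i *: z) e).
Qed.

End FieldDerivative.

Section LieBracket.
Context {R : realType} {V : vectType R}.
Variable g : {dot V for idfun}.
Implicit Types (K : twistor g) (X Y Z : twistor g -> 'End(V)).
Notation pt K := (v2r (phi K)).

Lemma local_ext_common (W W' : vectType R) (f : twistor g -> W) (h : twistor g -> W') K :
  smooth_at f K -> smooth_at h K ->
  exists F H U, [/\ near_pt K U, Coo U F, Coo U H,
    forall K', U (pt K') -> F (pt K') = v2r (f K') &
    forall K', U (pt K') -> H (pt K') = v2r (h K')].
Proof.
move=> [F [U [[oU UK] CF FE]]] [H [U' [[oU' UK'] CH HE]]].
exists F, H, (U `&` U'); split=> [|m|m|K' [u _]|K' [_ u]].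
- by split=> //; exact: openI.
- by apply: sub_Cm (CF m) => x [].
- by apply: sub_Cm (CH m) => x [].
- exact: FE.
- exact: HE.
Qed.

Lemma local_ext_dT (W : vectType R) (f : twistor g -> W) X K F H U :
  (forall K, tangent K (X K)) ->
  near_pt K U -> Coo U F -> Coo U H ->
  (forall K', U (pt K') -> F (pt K') = v2r (f K')) ->
  (forall K', U (pt K') -> H (pt K') = v2r (X K')) ->
  local_ext (fun K => dT f K (X K)) K (fun x => 'D_(H x) F x).
Proof.
move=> tX [oU UK] CF CH FE HE; exists U; split=> //; first exact: Coo_derive_along.
move=> K' UK'; rewrite HE //; apply/esym/dT_ext => //.
by exists U.
Qed.

(** A smooth extension of the right side near [K] is x |-> D_(Y x) F x, which by [dT_ext]
    is correct at all nearby points and not only at [K]. *)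
Lemma smooth_dT (W : vectType R) (f : twistor g -> W) X :
  smooth f -> smooth X -> (forall K, tangent K (X K)) -> smooth (fun K => dT f K (X K)).
Proof.
move=> sf sX tX K; have [F [Y [U [nU CF CY FE YE]]]] := local_ext_common (sf K) (sX K).
by exists (fun x => 'D_(Y x) F x); exact: local_ext_dT nU CF CY FE YE.
Qed.

(** The last summand is the Hessian of [F] evaluated on [Y] and [X]: it is symmetric and
    cancels in the commutator of two fields. *)
Lemma dT_dT (W : vectType R) (f : twistor g -> W) K F H (X : 'End(V)) Y U x :
  (forall K, tangent K (Y K)) -> tangent K X -> near_pt K U -> Coo U F -> Coo U H ->
  (forall K', U (pt K') -> F (pt K') = v2r (f K')) ->
  (forall K', U (pt K') -> H (pt K') = v2r (Y K')) ->
  x = pt K ->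
  v2r (dT (fun K => dT f K (Y K)) K X) =
   'D_(v2r (dT Y K X)) F x + 'D_(v2r (Y K)) ('D_(v2r X) F) x.
Proof.
move=> tY tX nU CF CH FE HE ->; have [oU UK] := nU.
rewrite (dT_ext (local_ext_dT tY nU CF CH FE HE) tX) (derive_derive_along _ oU UK CF CH).
by rewrite HE // (@dT_ext _ _ _ _ Y K X H) //; exists U.
Qed.

Lemma dT_lie_bracket (W : vectType R) X Y Z (f : twistor g -> W) K :
  smooth X -> smooth Y ->
  (forall K, tangent K (X K)) -> (forall K, tangent K (Y K)) -> tangent K (Z K) ->
  Z K = dT Y K (X K) - dT X K (Y K) -> smooth f ->
  dT f K (Z K) = dT (fun K' => dT f K' (Y K')) K (X K)
                 - dT (fun K' => dT f K' (X K')) K (Y K).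
Proof.
move=> sX sY tX tY tZ ZE sf.
have [F [HX [U1 [nU1 CF1 CX FE1 XE]]]] := local_ext_common (sf K) (sX K).
have [H0 [HY [U2 [nU2 CF2 CY FE2 YE]]]] := local_ext_common (sf K) (sY K).
have oI : open (U1 `&` U2) by apply: openI; [case: nU1|case: nU2].
have nI : near_pt K (U1 `&` U2) by split=> //; split; [case: nU1|case: nU2].
have CF : Coo (U1 `&` U2) F by move=> m; apply: sub_Cm (CF1 m) => x [].
have CX' : Coo (U1 `&` U2) HX by move=> m; apply: sub_Cm (CX m) => x [].
have CY' : Coo (U1 `&` U2) HY by move=> m; apply: sub_Cm (CY m) => x [].
have FE K' : (U1 `&` U2) (pt K') -> F (pt K') = v2r (f K') by case=> /FE1.
have XE' K' : (U1 `&` U2) (pt K') -> HX (pt K') = v2r (X K') by case=> /XE.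
have YE' K' : (U1 `&` U2) (pt K') -> HY (pt K') = v2r (Y K') by case=> _ /YE.
apply: v2r_inj; rewrite linearB /=.
have e1 := dT_dT tY (tX K) nI CF CY' FE YE' (erefl _).
have e2 := dT_dT tX (tY K) nI CF CX' FE XE' (erefl _).
have eF : local_ext f K F by exists (U1 `&` U2).
have e4 := Coo_derive_comm (v2r (X K)) (v2r (Y K)) oI nI.2 CF.
apply: etrans (dT_ext eF tZ) _.
apply: etrans _ (esym (congr2 (fun a b => a - b) e1 e2)).
have fin (a b d1 d2 : 'rV[R]_(dim W)) : d1 = d2 -> a - b = (a + d1) - (b + d2).
  by move=> ->; rewrite opprD addrACA subrr addr0.
apply: etrans _ (fin _ _ _ _ e4).
rewrite ZE addrC -scaleN1r linearP /= derive_linear_dir; last exact: Coo_diff CF nI.2.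
by rewrite scaleN1r addrC.
Qed.

Lemma is_lie_bracket_dT X Y Z : smooth X -> smooth Y ->
  (forall K, tangent K (X K)) -> (forall K, tangent K (Y K)) -> (forall K, tangent K (Z K)) ->
  (forall K, Z K = dT Y K (X K) - dT X K (Y K)) ->
  is_lie_bracket X Y Z.
Proof. by move=> sX sY tX tY tZ ZE f sf K; exact: dT_lie_bracket. Qed.

End LieBracket.

(** * Local triviality *)

(** A subspace of largest dimension inside [P] is all of [P], since adding a missing
    vector would enlarge it. *)
Lemma vspace_of_set (F : fieldType) (W : vectType F) (P : W -> Prop) :
  P 0 -> (forall a u v, P u -> P v -> P (a *: u + v)) ->
  exists U : {vspace W}, forall w, P w <-> w \in U.
Proof.
move=> P0 PL.
pose Q m := `[< exists U : {vspace W}, (forall w, w \in U -> P w) /\ \dim U = m >].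
have Q0 : exists m, Q m.
  exists 0%N; apply/asboolP; exists 0%VS; split; last exact: dimv0.
  by move=> w; rewrite memv0 => /eqP ->.
have Qb m : Q m -> (m <= \dim {:W})%N.
  by move=> /asboolP [U [_ <-]]; exact/dimvS/subvf.
case: (ex_maxnP Q0 Qb) => m /asboolP[U [UP dU]] mU.
exists U => w; split=> [Pw|]; last exact: UP.
apply: contraT => wU.
have /mU : Q (\dim (U + <[w]>)%VS).
  apply/asboolP; exists (U + <[w]>)%VS; split=> // x /memv_addP[u uU [v /vlineP[k ->] ->]].
  by rewrite addrC; apply: PL => //; exact: UP.
rewrite -dU => /(conj (addvSl U <[w]>)) /andP; rewrite -eqEdim => /eqP e.
by move/negP: wU; rewrite e; case; exact: (subvP (addvSr _ _) _ (memv_line w)).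
Qed.

Section Frames.
Context {R : realType} {V : vectType R}.
Variable g : {dot V for idfun}.
Implicit Types (K : twistor g) (A B : 'End(V)).
Notation pt K := (v2r (phi K)).

(** The bijection B |-> M B N from the fibre at [K0] to the fibre at [K] carries a fixed
    basis of the fibre at [K0] to a frame, smooth in [K] since [M] and [N] are. *)
Lemma conjugation_frame (E : bundle g) K0 (M N : twistor g -> 'End(V)) U :
  smooth M -> smooth N -> near_pt K0 U ->
  E K0 0 -> (forall a A B, E K0 A -> E K0 B -> E K0 (a *: A + B)) ->
  (forall K, U (pt K) -> [/\ lker (M K) == 0%VS, lker (N K) == 0%VS &
     forall B, E K (M K \o B \o N K)%VF <-> E K0 B]) ->
  exists (m : nat) (b : 'I_m -> section g) U,
    near_pt K0 U /\
    forall K, U (v2r (phi K)) ->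
      [/\ forall i, smooth_at (b i) K,
          free [tuple b i K | i < m] &
          E K = [set A | A \in <<[tuple b i K | i < m]>>%VS]].
Proof.
move=> sM sN nU E0 EL UE; have [W WE] := vspace_of_set E0 EL.
pose b (i : 'I_(\dim W)) K := (M K \o tnth (vbasis W) i \o N K)%VF.
exists (\dim W), b, U; split=> // K UK; have [kM kN EK] := UE K UK.
pose T B := (M K \o B \o N K)%VF.
have lT : linear T.
  by move=> a A B; rewrite /T comp_lfunDr comp_lfunDl -comp_lfunZr -comp_lfunZl.
pose LT : {linear 'End(V) -> 'End(V)} := HB.pack T (GRing.isLinear.Build R _ _ _ T lT).
have fE B : linfun LT B = T B by rewrite lfunE.
have injT : (lker (linfun LT) == 0)%VS.
  apply/lker0P => A B; rewrite !fE => e.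
  have h C : ((M K)^-1 \o (T C) \o (N K)^-1)%VF = C.
    by rewrite /T !comp_lfunA lker0_compVf // comp_lfun1l -comp_lfunA lker0_compfV // comp_lfun1r.
  by rewrite -(h A) e h.
have bE : [tuple b i K | i < \dim W] = map (linfun LT) (vbasis W) :> seq _.
  rewrite -[in RHS](map_tnth_enum (vbasis W)) -map_comp /=.
  by apply: eq_map => i /=; rewrite fE.
have bas : basis_of (linfun LT @: W)%VS (map (linfun LT) (vbasis W)).
  by apply: limg_basis_of; [rewrite (eqP injT) capv0|exact: vbasisP].
split.
- by move=> i; apply: smoothM => //; apply: smoothM => //; exact: smooth_cst.
- by rewrite bE; exact: basis_free bas.
rewrite bE (span_basis bas); apply/seteqP; split=> A /=.
  pose B := ((M K)^-1 \o A \o (N K)^-1)%VF.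
  have AE : A = T B.
    by rewrite /T /B !comp_lfunA lker0_compfV // comp_lfun1l -comp_lfunA lker0_compVf // comp_lfun1r.
  by rewrite AE => /EK /WE BW; rewrite -fE memv_img.
by move=> /memv_imgP[B /WE BE ->]; rewrite fE; exact/EK.
Qed.

Lemma constant_is_vector_bundle (E : bundle g) :
  (forall K K', E K = E K') -> (forall K, E K 0) ->
  (forall K a A B, E K A -> E K B -> E K (a *: A + B)) -> is_vector_bundle E.
Proof.
move=> cE E0 EL K0.
apply: (@conjugation_frame E K0 (fun=> \1%VF) (fun=> \1%VF) setT) => //.
- exact: smooth_cst.
- exact: smooth_cst.
- by split=> //; exact: openT.
- exact: EL.
have k1 : lker (\1%VF : 'End(V)) == 0%VS by apply/lker0P => x y; rewrite !lfunE.
by move=> K _; split=> // B; rewrite comp_lfun1l comp_lfun1r (cE K K0).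
Qed.

Lemma oV_is_vector_bundle : is_vector_bundle (fun _ : twistor g => oV g).
Proof.
apply: constant_is_vector_bundle => // [K|K a A B hA hB]; first exact: oV0.
by apply: oVD => //; exact: oVZ.
Qed.

(** Covers all the bundles E^S other than the full one: [e] = 1 gives the endomorphisms
    that commute with [gam], [e] = -1 those that anti-commute with it. *)
Definition eps_bundle (gam : section g) (e : R) : bundle g :=
  fun K => [set A | oV g A /\ (gam K \o A)%VF = e *: (A \o gam K)%VF].

Lemma eps_bundle0 gam e K : eps_bundle gam e K 0.
Proof. by split; [exact: oV0|rewrite comp_lfun0r comp_lfun0l scaler0]. Qed.

Lemma eps_bundleP gam e K a A B : eps_bundle gam e K A -> eps_bundle gam e K B ->
  eps_bundle gam e K (a *: A + B).
Proof.
move=> [sA hA] [sB hB]; split; first by apply: oVD => //; exact: oVZ.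
rewrite comp_lfunDr comp_lfunDl -comp_lfunZl -comp_lfunZr hA hB.
by rewrite scalerDr !scalerA mulrC.
Qed.

(** M = 1 - K K0 satisfies K M = K + K0 = M K0, and its adjoint N = 1 - K0 K satisfies
    N K = K0 N.  So B |-> M B N preserves skewness and trades K0 for K.  At K = K0 both
    are 2, hence they are invertible nearby. *)
Lemma phi_is_vector_bundle e : is_vector_bundle (eps_bundle (@phi _ _ g) e).
Proof.
move=> K0; set k0 := phi K0.
have [k02 _] := phiP K0; have sk0 := twistor_oV (phiP K0).
pose M K := \1%VF - (phi K \o k0)%VF; pose N K := \1%VF - (k0 \o phi K)%VF.
pose g1 (x : 'rV[R]_(dim 'End(V))) := - (r2v x \o k0)%VF.
pose g2 (x : 'rV[R]_(dim 'End(V))) := - (k0 \o r2v x)%VF.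
have l1 : linear g1.
  by move=> a x y; rewrite /g1 linearP comp_lfunDl -comp_lfunZl opprD scalerN.
have l2 : linear g2.
  by move=> a x y; rewrite /g2 linearP comp_lfunDr -comp_lfunZr opprD scalerN.
pose G1 : {linear 'rV[R]_(dim 'End(V)) -> 'End(V)} := HB.pack g1 (GRing.isLinear.Build R _ _ _ g1 l1).
pose G2 : {linear 'rV[R]_(dim 'End(V)) -> 'End(V)} := HB.pack g2 (GRing.isLinear.Build R _ _ _ g2 l2).
pose U := [set x | lker (\1%VF + G1 x) == 0%VS] `&` [set x | lker (\1%VF + G2 x) == 0%VS].
apply: (@conjugation_frame _ K0 M N U).
- by apply: smoothB; [exact: smooth_cst|apply: smoothM; [exact: smooth_phi|exact: smooth_cst]].
- by apply: smoothB; [exact: smooth_cst|apply: smoothM; [exact: smooth_cst|exact: smooth_phi]].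
- split; first by apply: openI; exact: open_lker0.
  have k2 : lker (\1%VF - (k0 \o k0)%VF : 'End(V)) == 0%VS.
    have -> : \1%VF - (k0 \o k0)%VF = 2%:R *: \1%VF :> 'End(V).
      by rewrite k02 opprK scaler_nat mulr2n.
    apply/lker0P => x y; rewrite !scale_lfunE !id_lfunE.
    by apply: scalerI; rewrite pnatr_eq0.
  by split; rewrite /= /g1 /g2 v2rK.
- exact: eps_bundle0.
- exact: eps_bundleP.
move=> K [/=]; rewrite /g1 /g2 !v2rK -/(M K) -/(N K) => kM kN; split=> //.
have [k2 _] := phiP K; have sk := twistor_oV (phiP K).
have KM : (phi K \o M K = M K \o k0)%VF.
  by rewrite /M !lfun_compE k2 -comp_lfunA k02 !lfun_compE; vring.
have NK : (N K \o phi K = k0 \o N K)%VF.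
  by rewrite /N !lfun_compE k02 -comp_lfunA k2 !lfun_compE; vring.
have aMN : adjoint g (M K) (N K).
  apply: adjointD; first exact: adjoint1.
  apply: adjointN; have := adjointM (proj1 (oVP _ _) sk) (proj1 (oVP _ _) sk0).
  by rewrite !lfun_compE opprK.
move=> B; split=> -[sB hB]; split.
- move=> u v.
  have [u' ->] : exists u', u = N K u' by exists ((N K)^-1%VF u); rewrite lker0_lfunVK.
  have [v' ->] : exists v', v = N K v' by exists ((N K)^-1%VF v); rewrite lker0_lfunVK.
  by have := sB u' v'; rewrite !comp_lfunE aMN (adjointC aMN) => ->.
- have : (M K \o (k0 \o B) \o N K = M K \o (e *: (B \o k0)) \o N K)%VF.
    move: hB; rewrite !comp_lfunA KM => ->.
    by rewrite -!comp_lfunA NK -comp_lfunZl -comp_lfunZr !comp_lfunA.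
  have h C : ((M K)^-1 \o (M K \o C \o N K) \o (N K)^-1)%VF = C.
    by rewrite !comp_lfunA lker0_compVf // comp_lfun1l -comp_lfunA lker0_compfV // comp_lfun1r.
  by move/(congr1 (fun X => (M K)^-1 \o X \o (N K)^-1)%VF); rewrite !h.
- apply/oVP.
  have := adjointM (adjointM aMN (proj1 (oVP _ _) sB)) (adjointC aMN).
  by rewrite !lfun_compE.
- rewrite !comp_lfunA KM -(comp_lfunA (M K)) hB -comp_lfunZr -comp_lfunZl.
  by rewrite -!comp_lfunA NK.
Qed.

End Frames.

(** * The correspondence gamma to gamma~ *)

Section Tilde.
Context {R : realType} {V : vectType R}.
Variable g : {dot V for idfun}.
Variables (J : 'End(V)) (hJ : twistor g J) (hdim : (4 <= \dim {:V})%N).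
Implicit Types (K : twistor g) (A B : 'End(V)).

Lemma exists_orthogonal u w : exists2 v, v != 0 & g u v = 0 /\ g w v = 0.
Proof.
pose W := ({:V} :&: orthov g <[u]> :&: orthov g <[w]>)%VS.
have dW : (0 < \dim W)%N.
  have h1 := leq_dim_orthov1 g u {:V}.
  have h2 := leq_dim_orthov1 g w ({:V} :&: orthov g <[u]>).
  by rewrite -/W in h2; lia.
have W0 : W != 0%VS by rewrite -dimv_eq0 -lt0n.
exists (vpick W); first by rewrite vpick0.
have : vpick W \in W by exact: memv_pick.
by rewrite !memv_cap !mem_orthov1 => /andP[/andP[_ /eqP a] /eqP b]; rewrite metricC a metricC b.
Qed.

(** For [A] skew, A + J A J is skew and anti-commutes with [J], and it vanishes only if
    [A] commutes with [J].  A = u /\ v with [v] orthogonal to [u] and [J u] does not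
    commute with [J], because A J u = 0 while J A u = g(u, u) J v. *)
Lemma exists_skew_anticommuting :
  exists B, [/\ oV g B, (B \o J)%VF = - (J \o B)%VF & B != 0].
Proof.
have [J2 _] := hJ; have sJ := twistor_oV hJ.
have [u u0] : exists u : V, u != 0.
  exists (vpick {:V}); rewrite vpick0 -dimv_eq0; lia.
have [v v0 [uv Juv]] := exists_orthogonal u (J u).
pose a x := g u x *: v - g v x *: u.
have la : linear a.
  move=> c x y; rewrite /a !metricE !scalerDl scalerBr -!scalerA; vring.
pose LA : {linear V -> V} := HB.pack a (GRing.isLinear.Build R _ _ _ a la).
pose A := linfun LA.
have AE x : A x = g u x *: v - g v x *: u by rewrite lfunE.
have sA : oV g A.
  move=> x y; rewrite !AE !metricE.
  by rewrite (metricC g v x) (metricC g u y) (metricC g v y) (metricC g u x); ring.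
exists (A + (J \o A \o J)%VF); split.
- apply: oVD => //; apply/oVP.
  have := adjointM (adjointM (proj1 (oVP _ _) sJ) (proj1 (oVP _ _) sA)) (proj1 (oVP _ _) sJ).
  by rewrite !lfun_compE !opprK.
- by rewrite !lfun_compE J2 -!comp_lfunA J2 !lfun_compE; vring.
apply/eqP => B0.
have : ((J \o (A + (J \o A \o J)%VF))%VF u) = 0 by rewrite B0 comp_lfun0r lfunE.
rewrite !lfun_compE J2 !lfun_compE add_lfunE opp_lfunE !comp_lfunE !AE.
rewrite (metricC g v u) uv (metricC g v (J u)) Juv !scale0r !subr0.
have -> : g u (J u) = 0 by have := sJ u u; rewrite metricC => e; lra.
rewrite scale0r subr0 linearZ /= => /eqP; rewrite scaler_eq0 metric_eq0 (negbTE u0) /=.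
move=> /eqP Jv; have : (J \o J)%VF v = 0 by rewrite comp_lfunE Jv linear0.
by rewrite J2 opp_lfunE lfunE /= => /eqP; rewrite oppr_eq0 (negbTE v0).
Qed.

(** The Cayley transform K0 = M J M^-1 with M = 1 + B, for [B] as above: then
    (J + K0) M = J M + M J = 2 J is invertible.  If [J] commuted with [K0], comparing
    K0 J M = J K0 M and K0 M J would give K0 J = -1 and then B = - B. *)
Lemma exists_generic_twistor : exists K0,
  (forall A, (A \o (J + phi K0) = 0)%VF -> A = 0) /\ commE J (phi K0) != 0.
Proof.
have [B [sB BJ B0]] := exists_skew_anticommuting; have [J2 _] := hJ.
have tK := cayley_twistor hJ sB BJ; have kM := lker_skew sB.
have [K0 KE] := twistor_point tK; exists K0; rewrite KE; set M := \1%VF + B in kM *.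
set k := (M \o J \o M^-1)%VF.
have kME : (k \o M = M \o J)%VF by rewrite /k lker0_compfVK.
have JM : (J \o M)%VF + (M \o J)%VF = 2%:R *: J.
  by rewrite /M !lfun_compE BJ scaler_nat mulr2n; vring.
split=> [A A0|].
  have : (A \o (J + k) \o M)%VF = 0 by rewrite A0 comp_lfun0l.
  rewrite -comp_lfunA comp_lfunDl kME JM -comp_lfunZr => /eqP.
  rewrite scaler_eq0 pnatr_eq0 /= => /eqP AJ.
  have : (A \o J \o J)%VF = 0 by rewrite AJ comp_lfun0l.
  by rewrite -comp_lfunA J2 comp_lfunNr comp_lfun1r => /eqP; rewrite oppr_eq0 => /eqP.
apply: contra B0 => /eqP; rewrite /commE => /eqP; rewrite subr_eq0 => /eqP Jk.
have e1 : (k \o J)%VF + (k \o J \o B)%VF = - (\1%VF - B).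
  have -> : (k \o J)%VF + (k \o J \o B)%VF = (J \o (k \o M))%VF.
    by rewrite comp_lfunA Jk /M !lfun_compE.
  by rewrite kME /M comp_lfunDl BJ !lfun_compE J2 !lfun_compE; vring.
have e2 : (k \o J)%VF - (k \o J \o B)%VF = - (\1%VF + B).
  have -> : (k \o J)%VF - (k \o J \o B)%VF = (k \o M \o J)%VF.
    by rewrite -(comp_lfunA k M J) /M comp_lfunDl BJ !lfun_compE.
  by rewrite kME -comp_lfunA J2 comp_lfunNr comp_lfun1r.
have kJ : (k \o J = - \1)%VF.
  have : 2%:R *: (k \o J)%VF = 2%:R *: (- \1%VF).
    have -> : 2%:R *: (k \o J)%VF = ((k \o J)%VF + (k \o J \o B)%VF) + ((k \o J)%VF - (k \o J \o B)%VF).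
      by rewrite scaler_nat mulr2n; vring.
    by rewrite e1 e2 scaler_nat mulr2n; vring.
  by apply: scalerI; rewrite pnatr_eq0.
move: e1; rewrite kJ !lfun_compE => /eqP; rewrite -subr_eq0.
have -> : - \1%VF - B - - (\1%VF - B) = - (2%:R *: B).
  by rewrite scaler_nat mulr2n; vring.
by rewrite oppr_eq0 scaler_eq0 pnatr_eq0.
Qed.

(** Everything follows from K0 with J + K0 cancellable and [J, K0] nonzero, and from its
    opposite.  For S = J + phi, S (J - phi) is - [J, phi] and S (J + phi) is a square of
    J + phi; for S = [J, phi], S (J + phi) = 0 would force [J, phi] = 0. *)
Lemma S_separates_J_phi (S : section g) : S_set J S ->
  (exists K, (S K \o J)%VF <> (S K \o phi K)%VF) /\
  (exists K, (S K \o J)%VF <> - (S K \o phi K)%VF).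
Proof.
have [K0 [canc c0]] := exists_generic_twistor; have [J2 _] := hJ.
have [k2 _] := phiP K0; set k := phi K0 in canc c0 k2.
have [K1 K1E] := twistor_point (twistorN (phiP K0)); rewrite -/k in K1E.
have cN A : (A \o J)%VF = - (A \o k)%VF -> A = 0.
  by move=> e; apply: canc; rewrite comp_lfunDr e addNr.
have n1 : \1%VF <> 0 :> 'End(V).
  by move=> e; move/eqP: c0; apply; rewrite -[LHS]comp_lfun1l e comp_lfun0l.
(* the eight cases reduce to these non-equalities, at K0 or at - K0 *)
have f0 : (J \o k)%VF <> (k \o J)%VF by move=> e; move/eqP: c0; apply; rewrite /commE e subrr.
have f1 : ((J + k) \o J)%VF <> ((J + k) \o k)%VF.
  by rewrite !comp_lfunDl J2 k2 addrC => /addIr /esym.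
have f2 : ((J + k) \o J)%VF <> - ((J + k) \o k)%VF.
  by move=> /cN a0; apply: n1; apply: canc; rewrite comp_lfun1l.
have f3 : (commE J k \o J)%VF <> - (commE J k \o k)%VF.
  by move=> /cN e; move/eqP: c0.
case=> ->; split.
- by exists K0; rewrite !comp_lfun1l -/k => e; apply: f0; rewrite e.
- exists K0; rewrite !comp_lfun1l -/k => e; apply: f0.
  by rewrite e !lfun_compE.
- by exists K0.
- by exists K0.
- by exists K1; rewrite K1E opprK comp_lfunNr.
- by exists K1; rewrite K1E opprK comp_lfunNr opprK.
- exists K1; rewrite K1E => e; apply: f3; move: e.
  have -> : commE J (- k) = - commE J k by rewrite /commE !lfun_compE; vring.
  by rewrite !comp_lfunNl comp_lfunNr opprK => <-; rewrite opprK.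
- by exists K0.
Qed.

(** The difference of two distinct elements of {J, -J, phi, -phi} is, up to a sign, 2 J,
    2 phi, J - phi or J + phi, and [S] annihilates none of them on the whole space. *)
Lemma pmJphi_right_cancel (S gam gam' : section g) : S_set J S -> pmJphi J gam -> pmJphi J gam' ->
  (forall K, (S K \o gam K)%VF = (S K \o gam' K)%VF) -> gam = gam'.
Proof.
move=> /S_separates_J_phi [[K1 h1] [K2 h2]].
have [J2 _] := hJ.
have s0 K A B : (A \o A)%VF = - \1%VF -> (S K \o A)%VF = - (S K \o A)%VF -> (S K \o B)%VF = 0.
  move=> A2 e; have : 2%:R *: (S K \o A)%VF = 0 by rewrite scaler_nat mulr2n {1}e addNr.
  move=> /eqP; rewrite scaler_eq0 pnatr_eq0 /= => /eqP SA.
  suff -> : S K = 0 by rewrite comp_lfun0l.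
  have : (S K \o A \o A)%VF = 0 by rewrite SA comp_lfun0l.
  by rewrite -comp_lfunA A2 comp_lfunNr comp_lfun1r => /eqP; rewrite oppr_eq0 => /eqP.
have P1 : ~ forall K, (S K \o J)%VF = (S K \o phi K)%VF by move=> /(_ K1).
have P2 : ~ forall K, (S K \o J)%VF = - (S K \o phi K)%VF by move=> /(_ K2).
have P3 : ~ forall K, (S K \o J)%VF = - (S K \o J)%VF.
  by move=> /(_ K1) e; apply: h1; rewrite (s0 _ J J J2 e) (s0 _ J (phi K1) J2 e).
have P4 : ~ forall K, (S K \o phi K)%VF = - (S K \o phi K)%VF.
  have k2 := proj1 (phiP K1).
  by move=> /(_ K1) e; apply: h1; rewrite (s0 _ (phi K1) J k2 e) (s0 _ (phi K1) (phi K1) k2 e).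
have NN (s : section g) K : (S K \o opp_sec s K)%VF = - (S K \o s K)%VF by exact: comp_lfunNr.
case=> -> [] -> // h; exfalso.
- by apply: P3 => K; rewrite {1}(h K) NN.
- by apply: P2 => K; rewrite (h K) NN.
- by apply: P3 => K; rewrite -{1}(h K) NN.
- by apply: P2 => K; rewrite -(h K) NN opprK.
- by apply: P1 => K; apply: oppr_inj; rewrite -!NN -(h K) NN.
- by apply: P1 => K; rewrite -(h K).
- by apply: P2 => K; rewrite (h K) NN opprK.
- by apply: P4 => K; rewrite {1}(h K) NN.
- by apply: P2 => K; rewrite -NN (h K).
- by apply: P1 => K; apply: oppr_inj; rewrite -!NN (h K) NN.
- by apply: P4 => K; rewrite -{1}(h K) NN.
Qed.

Lemma pmJphi_opp (s : section g) : pmJphi J s -> pmJphi J (opp_sec s).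
Proof.
have oo (t : section g) : opp_sec (opp_sec t) = t.
  by apply/funext=> K; rewrite /opp_sec opprK.
by case=> ->; rewrite ?oo; [apply: Or42|apply: Or41|apply: Or44|apply: Or43].
Qed.

Definition S_intertwines (S gam gam' : section g) : Prop :=
  [/\ pmJphi J gam',
    forall K, (gam K \o S K)%VF = (S K \o gam' K)%VF &
    forall K, (S K \o gam K)%VF = (gam' K \o S K)%VF].

Lemma S_intertwines_opp (S gam gam' : section g) :
  S_intertwines S gam gam' -> S_intertwines S (opp_sec gam) (opp_sec gam').
Proof.
move=> [pg e1 e2]; split=> [|K|K]; first exact: pmJphi_opp.
  by rewrite /opp_sec comp_lfunNl comp_lfunNr e1.
by rewrite /opp_sec comp_lfunNl comp_lfunNr e2.
Qed.

Lemma S_intertwines_exists (S gam : section g) : S_set J S -> pmJphi J gam ->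
  exists gam', S_intertwines S gam gam'.
Proof.
have [J2 _] := hJ; move=> SS Sg.
have tJ : exists gam', S_intertwines S (cst_sec J) gam'.
  case: SS => ->; rewrite /cst_sec.
  - by exists (cst_sec J); split; [apply: Or41|move=> K; rewrite !lfun_compE..].
  - exists (@phi _ _ g); split; [exact: Or43|move=> K..];
      rewrite !lfun_compE J2 (proj1 (phiP K)); vring.
  - exists (opp_sec (@phi _ _ g)); split; [exact: Or44|move=> K..];
      rewrite /opp_sec !lfun_compE J2 (proj1 (phiP K)); vring.
  - exists (opp_sec (cst_sec J)); split; [exact: Or42|move=> K..];
      rewrite /opp_sec /cst_sec /commE !lfun_compE J2 -?comp_lfunA J2 !lfun_compE; vring.
have tp : exists gam', S_intertwines S (@phi _ _ g) gam'.
  case: SS => ->.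
  - by exists (@phi _ _ g); split; [apply: Or43|move=> K; rewrite /cst_sec !lfun_compE..].
  - exists (cst_sec J); split; [exact: Or41|move=> K..];
      rewrite /cst_sec !lfun_compE J2 (proj1 (phiP K)); vring.
  - exists (opp_sec (cst_sec J)); split; [exact: Or42|move=> K..];
      rewrite /opp_sec /cst_sec !lfun_compE J2 (proj1 (phiP K)); vring.
  - exists (opp_sec (@phi _ _ g)); split; [exact: Or44|move=> K..];
      rewrite /opp_sec /commE !lfun_compE (proj1 (phiP K)) -?comp_lfunA (proj1 (phiP K)) !lfun_compE; vring.
case: Sg => ->; [exact: tJ| |exact: tp|].
  by have [t /S_intertwines_opp] := tJ; exists (opp_sec t).
by have [t /S_intertwines_opp] := tp; exists (opp_sec t).
Qed.

Lemma tildeP (S gam : section g) : S_set J S -> pmJphi J gam ->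
  S_intertwines S gam (tilde J S gam).
Proof. by move=> SS Sg; apply: (xgetPex gam (S_intertwines_exists SS Sg)). Qed.

(** Both sides intertwine - gamma, so this is the uniqueness of gamma~. *)
Lemma tilde_opp (S gam : section g) : S_set J S -> pmJphi J gam ->
  tilde J S (opp_sec gam) = opp_sec (tilde J S gam).
Proof.
move=> SS Sg; have [p1 e1 _] := tildeP SS Sg.
have [p2 e2 _] := tildeP SS (pmJphi_opp Sg).
apply: (pmJphi_right_cancel SS p2 (pmJphi_opp p1)) => K.
by rewrite -e2 /opp_sec comp_lfunNl comp_lfunNr e1.
Qed.

Lemma pmJphi_sq (s : section g) K : pmJphi J s -> (s K \o s K)%VF = - \1%VF.
Proof.
have [J2 _] := hJ; have [k2 _] := phiP K.
by case=> ->; rewrite /opp_sec /cst_sec ?comp_lfunNl ?comp_lfunNr ?opprK.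
Qed.

Lemma pmJphi_oV (s : section g) K : pmJphi J s -> oV g (s K).
Proof.
have sJ := twistor_oV hJ; have sk := twistor_oV (phiP K).
by case=> ->; rewrite /opp_sec /cst_sec //; exact: oVN.
Qed.

Lemma pmJphi_smooth (s : section g) : pmJphi J s -> smooth s.
Proof.
case=> ->; [exact: smooth_cst|apply: smoothN; exact: smooth_cst|exact: smooth_phi|].
by apply: smoothN; exact: smooth_phi.
Qed.

Lemma eps_bundle_opp (s : section g) e : eps_bundle (opp_sec s) e = eps_bundle s e.
Proof.
apply/funext=> K; apply/seteqP; rewrite /eps_bundle /opp_sec; split=> A /= [sA]; rewrite comp_lfunNl comp_lfunNr scalerN.
  by move=> /oppr_inj.
by move=> ->.
Qed.

Lemma eps_bundle_is_vector_bundle (s : section g) e : pmJphi J s -> is_vector_bundle (eps_bundle s e).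
Proof.
have cJ : is_vector_bundle (eps_bundle (cst_sec J : section g) e).
  apply: constant_is_vector_bundle => //; first by move=> K; exact: eps_bundle0.
  by move=> K *; exact: eps_bundleP.
case=> ->; rewrite ?eps_bundle_opp //; exact: phi_is_vector_bundle.
Qed.

End Tilde.

(** * Derivatives of skew and self-adjoint sections *)

Section Brackets.
Context {R : realType} {V : vectType R}.
Variable g : {dot V for idfun}.
Implicit Types (K : twistor g) (A B : 'End(V)).

Lemma commEl a A B C : commE (a *: A + B) C = a *: commE A C + commE B C :> 'End(V).
Proof. by rewrite /commE comp_lfunDl comp_lfunDr -comp_lfunZl -comp_lfunZr; vring. Qed.
Lemma commEr a A B C : commE C (a *: A + B) = a *: commE C A + commE C B :> 'End(V).
Proof. by rewrite /commE comp_lfunDl comp_lfunDr -comp_lfunZl -comp_lfunZr; vring. Qed.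
Lemma commE_oV A B : oV g A -> oV g B -> oV g (commE A B).
Proof.
move=> /oVP sA /oVP sB; apply/oVP; rewrite /commE.
have := adjointD (adjointM sA sB) (adjointN (adjointM sB sA)).
by rewrite !(comp_lfunNl, comp_lfunNr) !opprK opprB [X in adjoint _ _ X]addrC.
Qed.
Lemma commE_jacobi A B C :
  commE A (commE B C) - commE B (commE A C) = commE (commE A B) C :> 'End(V).
Proof. by rewrite /commE !lfun_compE; vring. Qed.

(** The condition is linear, so it is inherited by the derivative. *)
Lemma dT_skew (A : twistor g -> 'End(V)) K X : smooth A -> (forall K, oV g (A K)) ->
  tangent K X -> oV g (dT A K X).
Proof.
move=> sA hA tX u v.
pose l B : R^o := g (B u) v + g u (B v).
have ll : linear l.
  by move=> a B C; rewrite /l !add_lfunE !scale_lfunE !metricE /= scalerDr addrACA.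
pose LL : {linear 'End(V) -> R^o} := HB.pack l (GRing.isLinear.Build R _ _ _ l ll).
have := @dT_linear _ _ g _ _ LL A K X sA tX.
have -> : (fun K => LL (A K)) = fun=> 0.
  by apply/funext => K'; rewrite /= /l (hA K' u v) addNr.
by rewrite dT_cst // => /esym/eqP; rewrite /= /l addr_eq0 => /eqP.
Qed.

Lemma dT_self_adjoint (A : twistor g -> 'End(V)) K X : smooth A -> (forall K, self_adjoint g (A K)) ->
  tangent K X -> self_adjoint g (dT A K X).
Proof.
move=> sA hA tX u v.
pose l B : R^o := g (B u) v - g u (B v).
have ll : linear l.
  move=> a B C; rewrite /l !add_lfunE !scale_lfunE !metricE /= scalerDr scalerN opprD.
  by rewrite addrACA.
pose LL : {linear 'End(V) -> R^o} := HB.pack l (GRing.isLinear.Build R _ _ _ l ll).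
have := @dT_linear _ _ g _ _ LL A K X sA tX.
have -> : (fun K => LL (A K)) = fun=> 0.
  by apply/funext => K'; rewrite /= /l (hA K' u v) subrr.
by rewrite dT_cst // => /esym/eqP; rewrite /= /l subr_eq0 => /eqP.
Qed.

Lemma dT0 (W : vectType R) (f : twistor g -> W) K : dT f K 0 = 0.
Proof. by rewrite /dT linear0 derive0 linear0. Qed.

(** [A, K] K = A K K - K A K while K [A, K] = K A K - K K A, and K K = -1. *)
Lemma tangent_comm K A : oV g A -> tangent K (commE A (phi K)).
Proof.
move=> sA; have [k2 _] := phiP K; split; first exact/commE_oV/twistor_oV/phiP.
by rewrite /acommE /commE !lfun_compE k2 -!comp_lfunA k2 !lfun_compE; vring.
Qed.

End Brackets.

(** * The anchor and the factors of dF *)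

Section Main.
Context {R : realType} {V : vectType R}.
Variable g : {dot V for idfun}.
Implicit Types (K : twistor g) (A B : 'End(V)).
Hypothesis hdim : (4 <= \dim {:V})%N.
Variables (J : 'End(V)) (hJ : twistor g J).
Variables (Q S F : twistor g -> 'End(V)).
Hypotheses (sQ : smooth Q) (aQ : forall K, self_adjoint g (Q K)).
Hypotheses (QJ : forall K, commE (Q K) J = 0) (Qp : forall K, commE (Q K) (phi K) = 0).
Hypotheses (hS : S_set J S) (FE : forall K, F K = (Q K \o S K)%VF).

Local Notation tl := (tilde J S).
Local Notation psi K A := (commE (F K \o A \o F K)%VF (phi K)).

Lemma Q_comm_pmJphi gam K : pmJphi J gam -> (Q K \o gam K)%VF = (gam K \o Q K)%VF.
Proof.
have qJ : (Q K \o J)%VF = (J \o Q K)%VF by apply/eqP; rewrite -subr_eq0; apply/eqP/QJ.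
have qp : (Q K \o phi K)%VF = (phi K \o Q K)%VF by apply/eqP; rewrite -subr_eq0; apply/eqP/Qp.
by case=> ->; rewrite /cst_sec /opp_sec ?comp_lfunNl ?comp_lfunNr ?qJ ?qp.
Qed.

(** [Q] commutes with [J] and phi, and [S] is a polynomial in them. *)
Lemma QS_comm K : (Q K \o S K)%VF = (S K \o Q K)%VF.
Proof.
have qJ := Q_comm_pmJphi K (Or41 _ _ _ (erefl _)); have qp := Q_comm_pmJphi K (Or43 _ _ _ (erefl _)).
rewrite /cst_sec in qJ.
case: hS => ->; first by rewrite comp_lfun1l comp_lfun1r.
- by rewrite comp_lfunDl comp_lfunDr qJ qp.
- by rewrite comp_lfunDl comp_lfunDr comp_lfunNl comp_lfunNr qJ qp.
by rewrite /commE comp_lfunDl comp_lfunDr comp_lfunNl comp_lfunNr !comp_lfunA qJ qp -!comp_lfunA qJ qp.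
Qed.

Lemma F_intertwines gam K : pmJphi J gam -> (gam K \o F K)%VF = (F K \o tl gam K)%VF /\
  (F K \o gam K)%VF = (tl gam K \o F K)%VF.
Proof.
move=> pg; have [pt e1 e2] := tildeP hJ hS pg; rewrite FE; split.
  by rewrite comp_lfunA -(Q_comm_pmJphi K pg) -!comp_lfunA e1.
by rewrite -comp_lfunA e2 comp_lfunA (Q_comm_pmJphi K pt) comp_lfunA.
Qed.

Lemma smooth_S : smooth S.
Proof.
have sp := @smooth_phi R V g; have sJ := @smooth_cst R V g _ J.
case: hS => ->; [exact: smooth_cst|exact: smoothD|exact: smoothB|exact: smooth_comm].
Qed.
Lemma smooth_F : smooth F.
Proof.
have -> : F = fun K => (Q K \o S K)%VF by apply/funext => K; exact: FE.
by apply: smoothM => //; exact: smooth_S.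
Qed.

Let pJ : pmJphi J (cst_sec J : section g). Proof. exact: Or41. Qed.
Let pp : pmJphi J (@phi _ _ g). Proof. exact: Or43. Qed.
Let sp := @smooth_phi R V g.

(** Among the four choices of [S] only the identity is self-adjoint; the others are skew. *)
Lemma S_adjoint K : adjoint g (S K) (S K) \/ oV g (S K).
Proof.
have sJ := twistor_oV hJ; have sk := twistor_oV (phiP K).
case: hS => ->; [left; exact: adjoint1|right..].
- exact: oVD. - by apply: oVD => //; exact: oVN. - exact: commE_oV.
Qed.
Lemma F_adjoint K : adjoint g (F K) (F K) \/ oV g (F K).
Proof.
have a := adjointM (aQ K); case: (S_adjoint K) => [h|/oVP h]; have := a _ _ h.
  by rewrite -QS_comm -FE; left.
by rewrite comp_lfunNl -QS_comm -FE => h'; right; apply/oVP.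
Qed.
Lemma FAF_skew K A : oV g A -> oV g (F K \o A \o F K)%VF.
Proof.
move=> /oVP sA; apply/oVP; case: (F_adjoint K) => [h|/oVP h].
  by have := adjointM (adjointM h sA) h; rewrite !lfun_compE.
by have := adjointM (adjointM h sA) h; rewrite !lfun_compE !opprK.
Qed.
Lemma FAF_lin K a A B :
  (F K \o (a *: A + B) \o F K)%VF = a *: (F K \o A \o F K)%VF + (F K \o B \o F K)%VF.
Proof. by rewrite comp_lfunDr comp_lfunDl -comp_lfunZr -comp_lfunZl. Qed.
Lemma psi_lin K a A B : psi K (a *: A + B) = a *: psi K A + psi K B.
Proof. by rewrite FAF_lin commEl. Qed.
Lemma smooth_FAF (A : section g) : smooth A -> smooth (fun K => F K \o A K \o F K)%VF.
Proof. by move=> sA; have sF := smooth_F; apply: smoothM => //; exact: smoothM. Qed.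
Lemma smooth_psi (A : section g) : smooth A -> smooth (fun K => psi K (A K)).
Proof. by move=> sA; apply: smooth_comm => //; exact: smooth_FAF. Qed.
Lemma psi_tangent K A : oV g A -> tangent K (psi K A).
Proof. by move=> sA; apply/tangent_comm/FAF_skew. Qed.
Lemma S_tangent K A : oV g A -> tangent K (commE (S K \o A \o S K)%VF (phi K)).
Proof.
move=> /oVP sA; apply/tangent_comm/oVP; case: (S_adjoint K) => [h|/oVP h].
  by have := adjointM (adjointM h sA) h; rewrite !lfun_compE.
by have := adjointM (adjointM h sA) h; rewrite !lfun_compE !opprK.
Qed.

(** gamma~ for gamma = phi moves phi across both copies of [F], so psi(A) is itself of
    the form F Y F.  This is what makes dS_(psi A) divisible by [F] on both sides. *)
Lemma psiE K A : psi K A = (F K \o commE A (tl (@phi _ _ g) K) \o F K)%VF.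
Proof.
have [e1 e2] := F_intertwines K pp.
by rewrite /commE !lfun_compE e1 -!comp_lfunA e2; vring.
Qed.

(** With Y = [A, t], t the transform of phi, psi(A) = F Y F.  As dphi_X = X, one has
    dS_X = 0, X, - X or [J, X] for the four choices of [S], so Z = 0, Y, - Y or [tJ, Y]
    with tJ the transform of [J].  In all but the first case [F] and [Z] are skew. *)
Lemma dS_psi_factors : exists Z : twistor g -> 'End(V) -> 'End(V),
  [/\ forall K a A B, Z K (a *: A + B) = a *: Z K A + Z K B,
      forall A : section g, smooth A -> smooth (fun K => Z K (A K)),
      forall K A, oV g A -> dT S K (psi K A) = (F K \o Z K A \o F K)%VF &
      forall K A, oV g A -> adjoint g (Z K A \o F K \o Q K)%VF (Q K \o F K \o Z K A)%VF].
Proof.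
pose t := tl (@phi _ _ g); pose tJ := tl (cst_sec J : section g).
have [pt _ _] := tildeP hJ hS pp; have [ptJ _ _] := tildeP hJ hS pJ.
have st := pmJphi_smooth pt; have stJ := pmJphi_smooth ptJ.
have adj K B : oV g (S K) -> oV g B -> adjoint g (B \o F K \o Q K)%VF (Q K \o F K \o B)%VF.
  move=> /oVP sS /oVP sB.
  have sF : adjoint g (F K) (- F K).
    by have := adjointM (aQ K) sS; rewrite comp_lfunNl -QS_comm -FE.
  by have := adjointM (adjointM sB sF) (aQ K); rewrite !lfun_compE !opprK.
have sJ := twistor_oV hJ; have sk K := twistor_oV (phiP K).
have sY K A : oV g A -> oV g (commE A (t K)) by move=> sA; apply: commE_oV => //; exact: (pmJphi_oV hJ K pt).
have smY (A : twistor g -> 'End(V)) : smooth A -> smooth (fun K => commE (A K) (t K)) by move=> sA; exact: smooth_comm.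
case: hS => SE.
- exists (fun _ _ => 0); split=> [*|*|K A sA|K A sA u v].
  + by rewrite scaler0 addr0.
  + exact: smooth_cst.
  + by rewrite SE dT_cst ?comp_lfun0r ?comp_lfun0l //; exact: psi_tangent.
  + by rewrite !comp_lfun0l !comp_lfun0r !lfunE /= linear0l linear0r.
- exists (fun K A => commE A (t K)); split=> [*|*|K A sA|K A sA].
  + exact: commEl.
  + exact: smY.
  + have tX := psi_tangent K sA.
    by rewrite SE dTD ?dT_cst ?dT_phi ?add0r // ?psiE //; exact: smooth_cst.
  + by apply: adj; [rewrite SE; exact: oVD|exact: sY].
- exists (fun K A => - commE A (t K)); split=> [*|*|K A sA|K A sA].
  + by rewrite commEl opprD scalerN.
  + by apply: smoothN; exact: smY.
  + have tX := psi_tangent K sA.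
    rewrite SE dTB ?dT_cst ?dT_phi ?sub0r // ?psiE; last exact: smooth_cst.
    by rewrite comp_lfunNr comp_lfunNl.
  + by apply: adj; [rewrite SE; apply: oVD => //; exact: oVN|apply: oVN; exact: sY].
- exists (fun K A => commE (tJ K) (commE A (t K))); split=> [*|*|K A sA|K A sA].
  + by rewrite commEl commEr.
  + by apply: smooth_comm => //; exact: smY.
  + have tX := psi_tangent K sA; have [e1 e2] := F_intertwines K pJ.
    rewrite SE dT_comm ?dT_cst ?dT_phi //; last exact: smooth_cst.
    have -> : commE 0 (phi K) = 0 :> 'End(V) by rewrite /commE comp_lfun0l comp_lfun0r subrr.
    rewrite add0r psiE -/t; move: (commE A (t K)) => Y.
    rewrite /cst_sec -/tJ in e1 e2.
    by rewrite /commE !lfun_compE e1 -!comp_lfunA e2; vring.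
  + apply: adj; [rewrite SE; exact: commE_oV|apply: commE_oV; last exact: sY].
    exact: (pmJphi_oV hJ K ptJ).
Qed.

(** * The bracket before projection *)

Section Core.
Variable Z : twistor g -> 'End(V) -> 'End(V).
Hypothesis Zl : forall K a A B, Z K (a *: A + B) = a *: Z K A + Z K B.
Hypothesis Zs : forall A : section g, smooth A -> smooth (fun K => Z K (A K)).
Hypothesis ZdS : forall K A, oV g A -> dT S K (psi K A) = (F K \o Z K A \o F K)%VF.
Hypothesis Zad : forall K A, oV g A -> adjoint g (Z K A \o F K \o Q K)%VF (Q K \o F K \o Z K A)%VF.
Variables (E : bundle g) (P : twistor g -> 'End(V) -> 'End(V)).
Hypothesis EoV : forall K A, E K A -> oV g A.
Hypothesis Evb : is_vector_bundle E.
Hypothesis hdQ : forall C, Gamma E C -> forall K,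
       dT Q K (psi K (C K)) =
       (Q K \o dT Q K (commE (S K \o C K \o S K)%VF (phi K)) \o Q K)%VF.

(** The element called q in the factorization dQ_(psi A) = Q q Q. *)
Definition dQ_along_SAS K A := dT Q K (commE (S K \o A \o S K)%VF (phi K)).
Definition dF_right_cofactor K A := (dQ_along_SAS K A \o Q K)%VF + (Z K A \o F K \o Q K)%VF.
Definition dF_left_cofactor K A := (Q K \o dQ_along_SAS K A)%VF + (Q K \o F K \o Z K A)%VF.
(** The terms of the bracket that are bilinear over functions. *)
Definition tensor_part K A B := ((dF_right_cofactor K A \o B)%VF + (B \o dF_left_cofactor K A)%VF)
  - ((dF_right_cofactor K B \o A)%VF + (A \o dF_left_cofactor K B)%VF)
  - ((A \o F K \o F K \o B)%VF - (B \o F K \o F K \o A)%VF).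
Definition raw_bracket (A B : section g) : section g := fun K =>
  dT B K (psi K (A K)) - dT A K (psi K (B K)) + tensor_part K (A K) (B K).

Lemma dQ_along_SAS_lin K a A B : dQ_along_SAS K (a *: A + B) = a *: dQ_along_SAS K A + dQ_along_SAS K B.
Proof.
by rewrite /dQ_along_SAS comp_lfunDr comp_lfunDl -comp_lfunZr -comp_lfunZl commEl dT_linear_dir.
Qed.
Lemma dF_right_cofactor_lin K a A B : dF_right_cofactor K (a *: A + B) = a *: dF_right_cofactor K A + dF_right_cofactor K B.
Proof.
rewrite /dF_right_cofactor dQ_along_SAS_lin Zl !comp_lfunDl -!comp_lfunZl.
move: (dQ_along_SAS K A) (dQ_along_SAS K B) (Z K A) (Z K B) => x y z w; vring.
Qed.
Lemma dF_left_cofactor_lin K a A B : dF_left_cofactor K (a *: A + B) = a *: dF_left_cofactor K A + dF_left_cofactor K B.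
Proof.
rewrite /dF_left_cofactor dQ_along_SAS_lin Zl !comp_lfunDr -!comp_lfunZr.
move: (dQ_along_SAS K A) (dQ_along_SAS K B) (Z K A) (Z K B) => x y z w; vring.
Qed.
Lemma tensor_part_lin K a A B C : tensor_part K (a *: A + B) C = a *: tensor_part K A C + tensor_part K B C.
Proof.
rewrite /tensor_part dF_right_cofactor_lin dF_left_cofactor_lin.
move: (dF_right_cofactor K A) (dF_right_cofactor K B) (dF_left_cofactor K A) (dF_left_cofactor K B) (dF_right_cofactor K C) (dF_left_cofactor K C) => x y z w u v.
rewrite !(comp_lfunDl, comp_lfunDr) -!(comp_lfunZr, comp_lfunZl).
vring.
Qed.
Lemma tensor_part_anti K A B : tensor_part K A B = - tensor_part K B A.
Proof.
rewrite /tensor_part; move: (dF_right_cofactor K A) (dF_left_cofactor K A) (dF_right_cofactor K B) (dF_left_cofactor K B) => x y z w; vring.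
Qed.
Lemma tensor_part_linr K a A B C : tensor_part K C (a *: A + B) = a *: tensor_part K C A + tensor_part K C B.
Proof. by rewrite tensor_part_anti tensor_part_lin opprD -scalerN -!tensor_part_anti. Qed.

Lemma dQ_along_SAS_self_adjoint K A : oV g A -> self_adjoint g (dQ_along_SAS K A).
Proof. by move=> sA; apply: dT_self_adjoint => //; exact: S_tangent. Qed.

Lemma dF_cofactors_adjoint K A : oV g A -> adjoint g (dF_right_cofactor K A) (dF_left_cofactor K A).
Proof.
move=> sA; apply: adjointD; last exact: Zad.
by apply: adjointM; [exact: dQ_along_SAS_self_adjoint|exact: aQ].
Qed.

Lemma FF_self_adjoint K : adjoint g (F K \o F K)%VF (F K \o F K)%VF.
Proof.
case: (F_adjoint K) => [h|/oVP h]; have := adjointM h h => //.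
by rewrite !lfun_compE opprK.
Qed.

Lemma tensor_part_skew K A B : oV g A -> oV g B -> oV g (tensor_part K A B).
Proof.
move=> sA sB.
have one C D : oV g C -> oV g D -> oV g ((dF_right_cofactor K C \o D)%VF + (D \o dF_left_cofactor K C)%VF).
  move=> sC /oVP sD; apply/oVP; have h := dF_cofactors_adjoint K sC.
  have := adjointD (adjointM h sD) (adjointM sD (adjointC h)).
  move: h; move: (dF_right_cofactor K C) (dF_left_cofactor K C) => l r _.
  by rewrite !(comp_lfunNl, comp_lfunNr) opprD [- (l \o D)%VF + _]addrC.
apply: oVD; first by apply: oVD; [exact: one|apply: oVN; exact: one].
apply/oVN/oVP; move/oVP : sA => sA; move/oVP : sB => sB.
have h := FF_self_adjoint K.
have := adjointD (adjointM (adjointM sA h) sB) (adjointN (adjointM (adjointM sB h) sA)).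
by rewrite !lfun_compE !opprK opprB [X in adjoint _ _ X]addrC.
Qed.

Lemma smooth_dF_cofactors (A : section g) : Gamma E A -> smooth (fun K => dF_right_cofactor K (A K)) /\ smooth (fun K => dF_left_cofactor K (A K)).
Proof.
move=> [sA eA]; have sF := smooth_F; have sS := smooth_S.
have sq : smooth (fun K => dQ_along_SAS K (A K)).
  apply: smooth_dT => // [|K]; last exact/S_tangent/EoV/eA.
  by apply: smooth_comm => //; do 2! apply: smoothM => //.
have sZ := Zs sA.
by split; apply: smoothD; repeat apply: smoothM => //.
Qed.

Lemma smooth_raw_bracket (A B : section g) : Gamma E A -> Gamma E B -> smooth (raw_bracket A B).
Proof.
move=> gA gB; have [sLA sRA] := smooth_dF_cofactors gA; have [sLB sRB] := smooth_dF_cofactors gB.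
have [sA eA] := gA; have [sB eB] := gB; have sF := smooth_F.
have tA K := psi_tangent K (EoV (eA K)); have tB K := psi_tangent K (EoV (eB K)).
apply: smoothD; first by apply: smoothB; apply: smooth_dT => //; exact: smooth_psi.
apply: smoothB; last by apply: smoothB; repeat apply: smoothM => //.
by apply: smoothB; apply: smoothD; apply: smoothM.
Qed.

Lemma raw_bracket_skew (A B : section g) K : Gamma E A -> Gamma E B -> oV g (raw_bracket A B K).
Proof.
move=> [sA eA] [sB eB].
have oA K' := EoV (eA K'); have oB K' := EoV (eB K').
apply: oVD; last exact: tensor_part_skew.
by apply: oVD; [|apply: oVN]; apply: dT_skew => //; exact: psi_tangent.
Qed.

Lemma raw_bracket_lin a (A B C : section g) : Gamma E A -> Gamma E B -> Gamma E C ->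
  forall K, raw_bracket (fun K => a *: A K + B K) C K = a *: raw_bracket A C K + raw_bracket B C K.
Proof.
move=> [sA eA] [sB eB] [sC eC] K; rewrite /raw_bracket tensor_part_lin psi_lin dT_linear_dir //.
have tC := psi_tangent K (EoV (eC K)).
rewrite (dTD (smoothZ a sA) sB tC) (dTZ a sA tC).
move: (dT _ _ _) (dT _ _ _) (dT A _ _) (dT B _ _) (tensor_part K _ _) (tensor_part K _ _) => x y z w u v.
vring.
Qed.

Lemma raw_bracket_anti (A B : section g) : forall K, raw_bracket A B K = - raw_bracket B A K.
Proof.
move=> K; rewrite /raw_bracket tensor_part_anti.
by move: (dT _ _ _) (dT _ _ _) (tensor_part _ _ _) => x y z; vring.
Qed.

Lemma dT_Z (W : vectType R) (f : twistor g -> W) K a X : smooth f ->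
  dT f K (a *: X) = a *: dT f K X.
Proof. by move=> sf; rewrite -[a *: X]addr0 dT_linear_dir // dT0 addr0. Qed.

Lemma psi_Z K a A : psi K (a *: A) = a *: psi K A.
Proof. by rewrite -[a *: A]addr0 psi_lin comp_lfun0r comp_lfun0l /commE comp_lfun0l comp_lfun0r subrr addr0. Qed.

Lemma tensor_part_Zr K a A B : tensor_part K A (a *: B) = a *: tensor_part K A B.
Proof.
have D00 : tensor_part K A 0 = 0.
  have := tensor_part_linr K (- 1) 0 0 A; rewrite scaler0 addr0 scaleN1r => ->.
  by rewrite addNr.
by rewrite -[a *: B]addr0 tensor_part_linr D00 addr0.
Qed.

Lemma raw_bracket_leibniz (A B : section g) (f : twistor g -> R^o) : Gamma E A -> Gamma E B -> smooth f ->
  forall K, raw_bracket A (fun K => f K *: B K) K = f K *: raw_bracket A B K + dT f K (psi K (A K)) *: B K.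
Proof.
move=> [sA eA] [sB eB] sf K; rewrite /raw_bracket psi_Z dT_Z // tensor_part_Zr.
rewrite dTS //; last exact/psi_tangent/EoV/eA.
move: (dT _ _ _) (dT _ _ _) (tensor_part _ _ _) (f K) (dT f _ _) => x y z c r.
by vring.
Qed.

(** F = S Q gives dF = dS Q + S dQ = F Z F Q + S Q q Q, and F = Q S gives
    dF = dQ S + Q dS = Q q Q S + Q F Z F. *)
Lemma dF_psi_factors (A : section g) K : Gamma E A ->
  dT F K (psi K (A K)) = (F K \o dF_right_cofactor K (A K))%VF /\
  dT F K (psi K (A K)) = (dF_left_cofactor K (A K) \o F K)%VF.
Proof.
move=> gA; have [sA eA] := gA; have oA := EoV (eA K).
have tX := psi_tangent K oA; have hq := hdQ gA K.
have sS := smooth_S.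
have F1 : F = fun K => (Q K \o S K)%VF by apply/funext => K'; exact: FE.
have F2 : F = fun K => (S K \o Q K)%VF by apply/funext => K'; rewrite FE QS_comm.
rewrite -/(dQ_along_SAS K (A K)) in hq.
split.
  rewrite {1}F2 dTM // hq ZdS // /dF_right_cofactor comp_lfunDr !comp_lfunA -QS_comm -FE addrC.
  by [].
rewrite {1}F1 dTM // hq ZdS // /dF_left_cofactor comp_lfunDl -!comp_lfunA -FE.
by [].
Qed.

(** In d(FBF) the derivative of the left [F] is written as F L_A and that of the right
    [F] as R_A F, so that each term starts and ends with [F]. *)
Lemma F_raw_bracket_F (A B : section g) K : Gamma E A -> Gamma E B ->
  (F K \o raw_bracket A B K \o F K)%VF =
    dT (fun K => F K \o B K \o F K)%VF K (psi K (A K))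
  - dT (fun K => F K \o A K \o F K)%VF K (psi K (B K))
  - commE (F K \o A K \o F K)%VF (F K \o B K \o F K)%VF.
Proof.
have key (C D : section g) : Gamma E C -> Gamma E D ->
    dT (fun K => F K \o D K \o F K)%VF K (psi K (C K)) =
    (F K \o dT D K (psi K (C K)) \o F K)%VF + (F K \o dF_right_cofactor K (C K) \o D K \o F K)%VF
    + (F K \o D K \o dF_left_cofactor K (C K) \o F K)%VF.
  move=> gC [sD eD]; have [dL dR] := dF_psi_factors K gC; have [sC eC] := gC.
  have sF := smooth_F; have tX := psi_tangent K (EoV (eC K)).
  have sFD : smooth (fun K => F K \o D K)%VF by exact: smoothM.
  rewrite (dTM sFD sF tX) (dTM sF sD tX) {1}dL dR.
  by move: (dT D _ _) (dF_right_cofactor _ _) (dF_left_cofactor _ _) => x y z; rewrite !lfun_compE; vring.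
move=> gA gB; rewrite (key A B gA gB) (key B A gB gA) /raw_bracket /tensor_part.
move: (dT B _ _) (dT A _ _) (dF_right_cofactor _ (A K)) (dF_left_cofactor _ (A K)) (dF_right_cofactor _ (B K)) (dF_left_cofactor _ (B K)) => x y z w u v.
rewrite /commE !lfun_compE; vring.
Qed.

(** The derivatives of phi contribute [M_B, psi A] - [M_A, psi B], which is
    - [[M_A, M_B], phi] by the Jacobi identity. *)
Lemma psi_raw_bracket (A B : section g) K : Gamma E A -> Gamma E B ->
  psi K (raw_bracket A B K) = dT (fun K => psi K (B K)) K (psi K (A K))
    - dT (fun K => psi K (A K)) K (psi K (B K)).
Proof.
move=> gA gB; have [sA eA] := gA; have [sB eB] := gB.
have tA := psi_tangent K (EoV (eA K)); have tB := psi_tangent K (EoV (eB K)).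
rewrite (F_raw_bracket_F K gA gB).
rewrite (dT_comm (smooth_FAF sB) sp tA) (dT_comm (smooth_FAF sA) sp tB) !dT_phi //.
move: (dT (fun K => F K \o B K \o F K)%VF _ _) (dT (fun K => F K \o A K \o F K)%VF _ _).
move: (F K \o A K \o F K)%VF (F K \o B K \o F K)%VF => a b x y.
have -> : commE b (commE a (phi K)) = commE a (commE b (phi K)) - commE (commE a b) (phi K).
  by rewrite -commE_jacobi opprB addrCA subrr addr0.
by move: (commE a (commE b (phi K))) => m; rewrite /commE !lfun_compE; vring.
Qed.

Hypothesis P_lin : forall K a A B, P K (a *: A + B) = a *: P K A + P K B.
Hypothesis P_smooth : forall A : section g, smooth A -> smooth (fun K => P K (A K)).
Hypothesis P_in : forall K A, oV g A -> E K (P K A).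
Hypothesis P_id : forall K A, E K A -> P K A = A.
Hypothesis P_psi : forall (A B : section g) K, Gamma E A -> Gamma E B -> psi K (P K (raw_bracket A B K)) = psi K (raw_bracket A B K).

Lemma P0 K : P K 0 = 0.
Proof. by have := P_lin K (- 1) 0 0; rewrite scaler0 addr0 scaleN1r addNr. Qed.

(** A pointwise projection [P] to [E] that does not change psi of the raw bracket turns
    the raw bracket into a skew algebroid bracket on [E].  The Leibniz rule survives
    because [P] is linear and fixes sections of [E]. *)
Lemma skew_algebroid_projected : exists br : section g -> section g -> section g,
  skew_algebroid E br (fun K A => psi K A).
Proof.
exists (fun (A B : section g) K => P K (raw_bracket A B K)); split=> //.
- split=> [A B gA gB|a A B C gA gB gC|A B gA gB].
  + split=> [|K]; first by apply: P_smooth; exact: smooth_raw_bracket.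
    by apply: P_in; exact: raw_bracket_skew.
  + by apply/funext => K; rewrite raw_bracket_lin // P_lin.
  + apply/funext => K; rewrite raw_bracket_anti.
    by rewrite -scaleN1r -[_ *: _]addr0 P_lin P0 addr0 scaleN1r.
- split=> [K A /EoV|K a A B _ _|A [sA _]]; first exact: psi_tangent.
    exact: psi_lin.
  exact: smooth_psi.
- move=> A B gA gB; have [sA eA] := gA; have [sB eB] := gB.
  apply: is_lie_bracket_dT => [||K|K|K|K]; try exact: smooth_psi.
  + exact/psi_tangent/EoV.
  + exact/psi_tangent/EoV.
  + by apply: psi_tangent; apply: EoV; apply: P_in; exact: raw_bracket_skew.
  + by rewrite P_psi // psi_raw_bracket.
- move=> A B f gA gB sf; have [sB eB] := gB; apply/funext => K.
  rewrite raw_bracket_leibniz // P_lin; congr (_ + _).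
  have PZ c C : P K (c *: C) = c *: P K C by rewrite -[c *: C]addr0 P_lin P0 addr0.
  by rewrite PZ P_id.
Qed.
End Core.

Lemma half_double (x : 'End(V)) : 2^-1 *: (x + x) = x.
Proof. by rewrite -mulr2n -[x *+ 2]scaler_nat scalerA mulVf ?scale1r // pnatr_eq0. Qed.

(** * The projection to E^S *)

Section EpsInstance.
Variables (gam : section g) (e : R).
Hypotheses (pg : pmJphi J gam) (ee : e * e = 1).

Local Notation s := (tl gam).

Definition eps_proj K A := 2^-1 *: (A - e *: (s K \o A \o s K)%VF).

Let ps : pmJphi J s. Proof. by have [] := tildeP hJ hS pg. Qed.

Lemma eps_proj_lin K a A B : eps_proj K (a *: A + B) = a *: eps_proj K A + eps_proj K B.
Proof.
rewrite /eps_proj comp_lfunDr comp_lfunDl -comp_lfunZr -comp_lfunZl; vring.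
Qed.

Lemma eps_proj_smooth (A : section g) : smooth A -> smooth (fun K => eps_proj K (A K)).
Proof.
move=> sA; have ss := pmJphi_smooth ps.
by apply: smoothZ; apply: smoothB => //; apply: smoothZ; repeat apply: smoothM => //.
Qed.

Lemma eps_proj_in K A : oV g A -> eps_bundle s e K (eps_proj K A).
Proof.
move=> sA; have ss := pmJphi_oV hJ K ps; have s2 := pmJphi_sq hJ K ps; split.
  apply: oVZ; apply: oVD => //; apply/oVN/oVZ/oVP.
  have := adjointM (adjointM (proj1 (oVP _ _) ss) (proj1 (oVP _ _) sA)) (proj1 (oVP _ _) ss).
  by rewrite !lfun_compE !opprK.
rewrite /eps_proj -comp_lfunZr -comp_lfunZl !(comp_lfunDl, comp_lfunDr, comp_lfunNl, comp_lfunNr).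
rewrite -!(comp_lfunZr, comp_lfunZl) !comp_lfunA s2 -(comp_lfunA _ (s K) (s K)) s2.
rewrite !(comp_lfunNl, comp_lfunNr, comp_lfun1l, comp_lfun1r).
move: (s K \o A)%VF (A \o s K)%VF => x y.
have xe : x = (e * e) *: x by rewrite ee scale1r.
by rewrite {1}xe; vring.
Qed.

Lemma eps_proj_id K A : eps_bundle s e K A -> eps_proj K A = A.
Proof.
move=> [_ h]; have s2 := pmJphi_sq hJ K ps.
rewrite /eps_proj h -comp_lfunZl -comp_lfunA s2 comp_lfunNr comp_lfun1r !scalerN scalerA ee scale1r opprK.
exact: half_double.
Qed.

Lemma F_eps_proj_F K A : (F K \o eps_proj K A \o F K)%VF =
  2^-1 *: ((F K \o A \o F K)%VF - e *: (gam K \o (F K \o A \o F K) \o gam K)%VF).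
Proof.
have [e1 e2] := F_intertwines K pg.
have key : (F K \o (s K \o A \o s K) \o F K)%VF = (gam K \o (F K \o A \o F K) \o gam K)%VF.
  by rewrite !comp_lfunA -e1 -!comp_lfunA -e2.
rewrite /eps_proj -comp_lfunZr -comp_lfunZl comp_lfunDr comp_lfunDl comp_lfunNr comp_lfunNl.
by rewrite -comp_lfunZr -comp_lfunZl key.
Qed.

End EpsInstance.

Lemma FAF_comm gam K A : pmJphi J gam -> eps_bundle (tl gam) 1 K A ->
  commE (F K \o A \o F K)%VF (gam K) = 0.
Proof.
move=> pg [_ h]; have [e1 e2] := F_intertwines K pg; rewrite scale1r in h.
apply/eqP; rewrite /commE subr_eq0 -[X in X == _]comp_lfunA e2 !comp_lfunA e1.
by rewrite -(comp_lfunA (F K) (tl gam K)) h !comp_lfunA.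
Qed.

Section Instances.
Variable Z : twistor g -> 'End(V) -> 'End(V).
Hypothesis Zl : forall K a A B, Z K (a *: A + B) = a *: Z K A + Z K B.
Hypothesis Zs : forall A : section g, smooth A -> smooth (fun K => Z K (A K)).
Hypothesis ZdS : forall K A, oV g A -> dT S K (psi K A) = (F K \o Z K A \o F K)%VF.
Hypothesis Zad : forall K A, oV g A -> adjoint g (Z K A \o F K \o Q K)%VF (Q K \o F K \o Z K A)%VF.

Definition dQ_condition (E : bundle g) := forall C, Gamma E C -> forall K,
       dT Q K (psi K (C K)) =
       (Q K \o dT Q K (commE (S K \o C K \o S K)%VF (phi K)) \o Q K)%VF.

Lemma eps_oV gam e K A : eps_bundle gam e K A -> oV g A. Proof. by case. Qed.

(** M_A and M_B commute with [gam]; so do their derivatives in direction psi, since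
    [gam] is either constant or phi, and in the latter case psi(A) = [M_A, phi] = 0. *)
Lemma comm_F_raw_bracket_F gam (A B : section g) K : gam = cst_sec J \/ gam = @phi _ _ g ->
  dQ_condition (eps_bundle (tl gam) 1) ->
  Gamma (eps_bundle (tl gam) 1) A -> Gamma (eps_bundle (tl gam) 1) B ->
  commE (F K \o raw_bracket Z A B K \o F K)%VF (gam K) = 0.
Proof.
move=> gE hdQ gA gB; have pg : pmJphi J gam by case: gE => ->.
rewrite (@F_raw_bracket_F Z ZdS (eps_bundle (tl gam) 1) (@eps_oV _ _) hdQ A B K gA gB).
have key (C D : section g) : Gamma (eps_bundle (tl gam) 1) C -> Gamma (eps_bundle (tl gam) 1) D ->
    commE (dT (fun K => F K \o D K \o F K)%VF K (psi K (C K))) (gam K) = 0.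
  move=> [sC eC] [sD eD]; have tX := psi_tangent K (eps_oV (eC K)).
  have sFDF := smooth_FAF sD.
  have h0 : (fun K => commE (F K \o D K \o F K)%VF (gam K)) = fun=> 0.
    by apply/funext => K'; exact: FAF_comm.
  have := dT_comm sFDF (pmJphi_smooth pg) tX; rewrite h0 dT_cst // => /esym.
  have -> : dT gam K (psi K (C K)) = 0.
    case: gE => gE; first by rewrite gE; exact: dT_cst.
    by rewrite {1}gE dT_phi // -gE; exact: FAF_comm.
  by rewrite [commE _ 0]/commE comp_lfun0l comp_lfun0r subrr addr0.
have [sA eA] := gA; have [sB eB] := gB.
have a0 := FAF_comm pg (eA K); have b0 := FAF_comm pg (eB K).
have k1 := key A B gA gB; have k2 := key B A gB gA.
move: k1 k2 a0 b0.
move: (dT (fun K => F K \o B K \o F K)%VF _ _) (dT (fun K => F K \o A K \o F K)%VF _ _).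
move: (F K \o A K \o F K)%VF (F K \o B K \o F K)%VF (gam K) => a b c x y xc yc ac bc.
have -> : commE (x - y - commE a b) c = commE x c - commE y c - commE (commE a b) c.
  by rewrite /commE !lfun_compE; vring.
rewrite xc yc -commE_jacobi ac bc /commE !comp_lfun0l !comp_lfun0r; vring.
Qed.

(** For [e] = 1 the compressed raw bracket is fixed by the projection; for [gam] = phi
    and [e] = -1 the projection only removes a part commuting with phi. *)
Lemma eps_instance gam e :
  (gam = cst_sec J /\ e = 1) \/ (gam = @phi _ _ g /\ (e = 1 \/ e = -1)) ->
  dQ_condition (eps_bundle (tl gam) e) ->
  exists br : section g -> section g -> section g,
    skew_algebroid (eps_bundle (tl gam) e) br (fun K A => psi K A).
Proof.
move=> gE hdQ.
have pg : pmJphi J gam by case: gE => -[-> _].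
have ee : e * e = 1 by case: gE => -[_]; [|case] => ->; rewrite ?mulrNN mulr1.
have [ps _ _] := tildeP hJ hS pg.
apply: (@skew_algebroid_projected Z Zl Zs ZdS Zad (eps_bundle (tl gam) e) (eps_proj gam e)).
- by move=> K A; exact: eps_oV.
- exact (eps_bundle_is_vector_bundle e ps).
- exact: hdQ.
- exact: eps_proj_lin.
- exact: eps_proj_smooth.
- exact: eps_proj_in.
- exact: eps_proj_id.
move=> A B K gA gB; rewrite (F_eps_proj_F e pg).
have e1P : e = 1 -> commE (F K \o raw_bracket Z A B K \o F K)%VF (gam K) = 0.
  move=> e1; rewrite e1 in hdQ gA gB; apply: comm_F_raw_bracket_F => //.
  by case: gE => -[-> _]; [left|right].
have s2 := pmJphi_sq hJ K pg.
move: e1P; set M := (F K \o raw_bracket Z A B K \o F K)%VF => e1P.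
have [e1|[gp em]] : e = 1 \/ (gam = @phi _ _ g /\ e = -1).
  by case: gE => -[gE]; [left|case=> eE; [left|right]].
  move: (e1P e1); rewrite /commE => /eqP; rewrite subr_eq0 => /eqP Mg.
  rewrite e1 scale1r -Mg -comp_lfunA s2 comp_lfunNr comp_lfun1r opprK.
  by rewrite half_double.
rewrite em scaleN1r opprK gp; have k2 := proj1 (phiP K).
clearbody M; move: (phi K) k2 => k k2.
have -> : commE (2^-1 *: (M + (k \o M \o k)%VF)) k = 2^-1 *: (commE M k + commE M k).
  rewrite /commE -comp_lfunZl -comp_lfunZr !(comp_lfunDl, comp_lfunDr) !comp_lfunA k2.
  by rewrite -(comp_lfunA (k \o M)%VF) k2 !lfun_compE; vring.
exact: half_double.
Qed.

Lemma orth_instance : dQ_condition (fun=> oV g) ->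
  exists br : section g -> section g -> section g,
    skew_algebroid (fun=> oV g) br (fun K A => psi K A).
Proof.
move=> hdQ.
apply: (@skew_algebroid_projected Z Zl Zs ZdS Zad (fun=> oV g) (fun _ A => A)) => //.
- exact: oV_is_vector_bundle.
Qed.
End Instances.

End Main.

Theorem theorem4p6 (R : realType) (V : vectType R) (g : {dot V for idfun})
    (n : nat) (hn : \dim {:V} = n.*2) (hdim : (4 <= \dim {:V})%N)
    (J : 'End(V)) (hJ : twistor g J)
    (Q S F : twistor g -> 'End(V)) (E : bundle_label)
    (hQ : smooth Q)
    (hQsa : forall K, self_adjoint g (Q K))
    (hQJ : forall K, commE (Q K) J = 0)
    (hQphi : forall K, commE (Q K) (phi K) = 0)
    (hS : S_set J S)
    (hF : forall K, F K = (Q K \o S K)%VF)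
    (hdQ : forall C, Gamma (twist J S E) C -> forall K,
       dT Q K (commE (F K \o C K \o F K)%VF (phi K)) =
       (Q K \o dT Q K (commE (S K \o C K \o S K)%VF (phi K)) \o Q K)%VF) :
  exists br : (twistor g -> 'End(V)) -> (twistor g -> 'End(V)) ->
              (twistor g -> 'End(V)),
    skew_algebroid (twist J S E) br
      (fun K A => commE (F K \o A \o F K)%VF (phi K)).
Proof.
have [Z [Zl Zs ZdS Zad]] := dS_psi_factors hJ hQsa hQJ hQphi hS hF.
have pp : pmJphi J (@phi _ _ g) by exact: Or43.
have twistE (gam : section g) e del : (forall K, del K = e *: tilde J S gam K) ->
    intertwine (tilde J S gam) del = eps_bundle (tilde J S gam) e.
  move=> dE; apply/funext => K; rewrite /intertwine /eps_bundle.
  by apply/seteqP; split=> A /= [sA]; rewrite dE -comp_lfunZr.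
case: E hdQ.
- exact: (orth_instance hJ hQ hQsa hQJ hQphi hS hF Zl Zs ZdS Zad).
- have -> : twist J S OrthAntiPhi = eps_bundle (tilde J S (@phi _ _ g)) (-1).
    apply: twistE => K; rewrite /= (tilde_opp hJ hdim hS pp) /opp_sec scaleN1r //.
  apply: (eps_instance hJ hQ hQsa hQJ hQphi hS hF Zl Zs ZdS Zad).
  by right; split=> //; right.
- have -> : twist J S UnitaryJ = eps_bundle (tilde J S (cst_sec J : section g)) 1.
    by apply: twistE => K; rewrite scale1r.
  apply: (eps_instance hJ hQ hQsa hQJ hQphi hS hF Zl Zs ZdS Zad).
  by left.
have -> : twist J S UnitaryPhi = eps_bundle (tilde J S (@phi _ _ g)) 1.
  by apply: twistE => K; rewrite scale1r.
apply: (eps_instance hJ hQ hQsa hQJ hQphi hS hF Zl Zs ZdS Zad).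
by right; split=> //; left.
Qed.
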